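(* Let $1\leq t\leq 4$, let $G$ be a planar graph with maximum degree $\Delta\geq 28-t$, and let $H$ be a subgraph of $G$ that is a set of distance-3 cliques. Then any total-$(\Delta+t)$-coloring of $H$ can be extended to a total-$(\Delta+t)$-coloring of $G$.
   Context: All graphs are simple. A total-$k$-coloring of a graph is an assignment of colors from $\{1,\dots,k\}$ to its vertices and edges such that adjacent vertices receive different colors, edges sharing an endpoint receive different colors, and no edge receives the same color as either of its endpoints. A subgraph $H$ of $G$ is a set of distance-3 cliques if $H$ is a disjoint union of vertex-disjoint cliques (possibly of different sizes) and any two vertices in distinct components of $H$ are at distance at least $3$ in $G$. Extending a total coloring $\varphi$ of $H$ to $G$ means finding a total-$k$-coloring of $G$ agreeing with $\varphi$ on all vertices and edges of $H$. *)

(* Defs.v *)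
From HB Require Import structures.
From mathcomp Require Import all_boot all_order all_algebra.
From mathcomp Require Import all_classical all_reals all_analysis.
From mathcomp Require Import Rstruct Rstruct_topology.

Set Implicit Arguments.
Unset Strict Implicit.
Unset Printing Implicit Defensive.

Import Order.TTheory GRing.Theory Num.Theory.

(* A simple graph: vertex type T : finType, symmetric irreflexive edge relation e. *)

Notation Real := Rdefinitions.R.

Definition planar (T : finType) (e : rel T) : Prop :=
  exists (pos : T -> (Real * Real)%type)
         (curve : T -> T -> Real -> (Real * Real)%type),
    injective pos /\
    (forall u v, e u v ->
       [/\ continuous (curve u v),
           curve u v 0%R = pos u,
           curve u v 1%R = pos v,
           (forall s s' : Real, (0 <= s <= 1)%R -> (0 <= s' <= 1)%R ->
               curve u v s = curve u v s' -> s = s') &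
           (forall (s : Real) (w : T), (0 < s < 1)%R -> curve u v s <> pos w)]) /\
    (forall u v x y, e u v -> e x y -> [set u; v] != [set x; y] ->
       forall s s' : Real, (0 < s < 1)%R -> (0 < s' < 1)%R ->
         curve u v s <> curve x y s').

Definition deg (T : finType) (e : rel T) (v : T) : nat := #|[set w | e v w]|.
Definition maxdeg (T : finType) (e : rel T) : nat := \max_(v : T) deg e v.

(* Total-k-coloring of the graph with vertex set V and edge relation e
   (edges are assumed to lie inside V). Colors are 1..k; the edge color
   ce u v is required to be symmetric on edges. *)
Definition total_coloring (T : finType) (V : {set T}) (e : rel T) (k : nat)
    (cv : T -> nat) (ce : T -> T -> nat) : Prop :=
  [/\ (forall v, v \in V -> 1 <= cv v <= k),
      (forall u v, e u v -> 1 <= ce u v <= k /\ ce u v = ce v u),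
      (forall u v, e u v -> cv u <> cv v),
      (forall u v w, e u v -> e u w -> v != w -> ce u v <> ce u w) &
      (forall u v, e u v -> ce u v <> cv u /\ ce u v <> cv v)].

(* H = (VH, eH) is a subgraph of G = (T, e) that is a set of distance-3 cliques:
   each component of H is a clique of H, and two vertices in distinct
   components of H are at distance at least 3 in G. *)
Definition distance3_cliques (T : finType) (e : rel T) (VH : {set T}) (eH : rel T)
    : Prop :=
  [/\ (forall u v, eH u v -> e u v),
      (forall u v, eH u v -> u \in VH /\ v \in VH),
      (forall u v, eH u v -> eH v u),
      (* components of H are cliques: adjacency in H (plus equality) is transitive *)
      (forall x y z, x != z -> eH x y -> eH y z -> eH x z) &
      (* vertices of distinct components are at distance >= 3 in G *)
      (forall x y, x \in VH -> y \in VH -> x != y -> ~~ eH x y ->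
         ~~ e x y /\ (forall w, ~~ (e x w && e w y)))].

(* Main.v *)
(** Put k = Delta + t, so that k >= 28 and every degree is less than k.

    Colouring.  Induct on the number of edges outside H.  Call a vertex low if it
    is outside H and has small degree: it can always be recoloured last.  An edge
    uv with u low and d(u) + d(v) <= k may be deleted, the rest coloured, and then
    uv and u coloured greedily.  Likewise, let X consist of low vertices of degree
    at most i <= 5 such that every neighbour of X has at least i neighbours in X.
    Delete all edges at X and colour the rest; a neighbour b of X then has at
    least as many free colours as deleted edges, and the deleted edges can be
    coloured from these lists by Galvin's kernel method, the preferences coming
    from a Konig edge colouring with i colours.  If neither reduction applies,
    then the low vertices of degree at most i number at most (i - 1)|B|, where B
    is the set of neighbours of low vertices of degree at most 5, and the vertices
    of B have degree at least 24.  A vertex outside the low part of H loses at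
    most 6 neighbours when the low part of H is deleted, so comparing degrees
    with 6 contradicts the sparsity of planar graphs.

    Sparsity.  By compactness a planar drawing can be digitised: the graph is a
    minor of a fine square grid.  Over F_2 every even subgraph of the grid bounds
    a set of cells, hence every even subgraph of the minor is determined by a set
    of its faces; counting gives |E| <= |V| - 1 + |F|, and every face has at least
    three edges. *)

Require Import Defs.
From mathcomp Require Import all_boot all_order all_algebra.
From mathcomp Require all_classical all_reals all_analysis.
From mathcomp Require Rstruct Rstruct_topology.
From mathcomp Require Import zify ring lra.

Set Implicit Arguments.
Unset Strict Implicit.
Unset Printing Implicit Defensive.

(** * List colouring of bipartite graphs *)

Definition adjacent_edges (A B : eqType) (x y : A * B) : bool :=
  (x != y) && ((x.1 == y.1) || (x.2 == y.2)).

Definition proper_on (A B : finType) (C : eqType) (Q : {set A * B})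
    (c : A * B -> C) : Prop :=
  forall x y, x \in Q -> y \in Q -> adjacent_edges x y -> c x != c y.

Lemma adjacent_edges_sym (A B : eqType) (x y : A * B) :
  adjacent_edges x y = adjacent_edges y x.
Proof. by rewrite /adjacent_edges eq_sym (eq_sym x.1) (eq_sym x.2). Qed.

Lemma card_le_inj_nat (T : finType) (S : {pred T}) (f : T -> nat) (n : nat) :
  {in S &, injective f} -> (forall x, x \in S -> f x < n) -> #|S| <= n.
Proof.
move=> fi fn; rewrite cardE -(size_map f) -(size_iota 0 n).
apply: uniq_leq_size.
  by rewrite map_inj_in_uniq ?enum_uniq // => x y; rewrite !mem_enum; exact: fi.
by move=> _ /mapP[x + ->]; rewrite mem_enum mem_iota => /fn.
Qed.

Lemma missing_color (T : finType) (S : {pred T}) (f : T -> nat) (n : nat) :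
  #|S| < n -> exists2 k, k < n & forall x, x \in S -> f x != k.
Proof.
move=> Sn; have [/allP h|/allPn[k]] := boolP (all [in map f (enum S)] (iota 0 n)).
  have := uniq_leq_size (iota_uniq 0 n) h; rewrite size_iota size_map -cardE.
  by rewrite leqNgt Sn.
rewrite mem_iota /= add0n => kn nk; exists k => // x xS.
by apply: contraNneq nk => <-; apply: map_f; rewrite mem_enum.
Qed.

(** * Koenig edge colouring and Galvin's list colouring theorem *)

Section Konig.
Variables (A B : finType).

(** Exchange [k] and [j] on the alternating walk from [a0]. The walk leaves [A] along edges coloured
    [j] and [B] along edges coloured [k], so it could reach [b0] only by an edge coloured [j], and
    there is none. Hence [j] becomes free at [a0] and stays free at [b0]. *)
Lemma kempe_swap (Q : {set A * B}) (c : A * B -> nat) (n k j : nat) (a0 : A) (b0 : B) :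
  proper_on Q c -> (forall x, x \in Q -> c x < n) -> k < n -> j < n ->
  (forall x, x \in Q -> x.1 = a0 -> c x != k) ->
  (forall x, x \in Q -> x.2 = b0 -> c x != j) ->
  exists c' : A * B -> nat, [/\ proper_on Q c', (forall x, x \in Q -> c' x < n) &
    forall x, x \in Q -> (x.1 == a0) || (x.2 == b0) -> c' x != j].
Proof.
move=> cQ cn kn jn ka jb.
pose r : rel (A + B) := fun u v => match u, v with
  | inl a, inr b => ((a, b) \in Q) && (c (a, b) == j)
  | inr b, inl a => ((a, b) \in Q) && (c (a, b) == k)
  | _, _ => false end.
pose C v := connect r (inl a0) v.
have Cstep u v : C u -> r u v -> C v by move=> Cu /connect1; exact: connect_trans.
have Clast v : C v -> v = inl a0 \/ exists2 u, C u & r u v.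
  move=> /connectP[p + ->]; elim/last_ind: p => [|p w _] /=; first by left.
  rewrite rcons_path last_rcons => /andP[pp rw]; right.
  by exists (last (inl a0) p) => //; apply/connectP; exists p.
have uniql x y : x \in Q -> y \in Q -> x.1 = y.1 -> c x = c y -> x = y.
  move=> xQ yQ e ce; apply/eqP; apply: contraT => ne.
  by have := cQ x y xQ yQ; rewrite /adjacent_edges ne e eqxx ce eqxx => /(_ isT).
have uniqr x y : x \in Q -> y \in Q -> x.2 = y.2 -> c x = c y -> x = y.
  move=> xQ yQ e ce; apply/eqP; apply: contraT => ne.
  by have := cQ x y xQ yQ; rewrite /adjacent_edges ne e eqxx orbT ce eqxx => /(_ isT).
have Cj x : x \in Q -> c x = j -> C (inl x.1) = C (inr x.2).
  case: x => a b xQ xj; apply/idP/idP => [Ca|Cb].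
    by apply: Cstep Ca _; rewrite /= xQ xj eqxx.
  have [//|[[a'|//] Ca' /andP[yQ /eqP yj]]] := Clast _ Cb.
  by have [->] := uniqr _ _ xQ yQ erefl (etrans xj (esym yj)).
have Ck x : x \in Q -> c x = k -> C (inl x.1) = C (inr x.2).
  case: x => a b xQ xk; apply/idP/idP => [Ca|Cb]; last first.
    by apply: Cstep Cb _; rewrite /= xQ xk eqxx.
  have [[ea]|[[//|b'] Cb' /andP[yQ /eqP yk]]] := Clast _ Ca.
    by have := ka _ xQ ea; rewrite xk eqxx.
  by have [->] := uniql _ _ xQ yQ erefl (etrans xk (esym yk)).
have Cb0 : ~~ C (inr b0).
  apply/negP => /Clast[//|[[a|//] _ /andP[yQ yj]]].
  by have := jb _ yQ erefl; rewrite yj.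
pose sw i := if i == k then j else if i == j then k else i.
have swK : involutive sw.
  move=> i; rewrite /sw; have [->|ik] := eqVneq i k; last first.
    by have [->|ij] := eqVneq i j; rewrite ?eqxx // (negPf ik) (negPf ij).
  by have [->|jk] := eqVneq j k; rewrite ?eqxx.
have swN i : i != k -> i != j -> sw i = i by rewrite /sw => /negPf-> /negPf->.
(* Testing the end in [A] suffices: by [Cj] and [Ck] an edge coloured [j] or [k] has both ends on
   the walk or neither, and [sw] fixes all other colours. *)
pose c' x := if C (inl x.1) then sw (c x) else c x.
have cr x y : x \in Q -> y \in Q -> x.2 = y.2 -> c' x = c' y -> x = y.
  move=> xQ yQ e.
  have [Cxy|Cxy] := eqVneq (C (inl x.1)) (C (inl y.1)).
    rewrite /c' Cxy; case: ifP => _; last exact: uniqr.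
    by move/(can_inj swK); exact: uniqr.
  have nn z : z \in Q -> ((c z == k) || (c z == j)) -> C (inl z.1) = C (inr z.2).
    by move=> zQ /orP[] /eqP; [exact: Ck|exact: Cj].
  wlog xs : x y xQ yQ e Cxy / (c x != k) && (c x != j) => [wl|].
    have [xs|] := boolP ((c x != k) && (c x != j)); first exact: wl.
    have [ys|] := boolP ((c y != k) && (c y != j)).
      by move=> _ e'; apply/esym; apply: wl => //; rewrite eq_sym.
    rewrite !negb_and !negbK => cy cx; case/negP: Cxy.
    by rewrite (nn x) // (nn y) // e.
  have /andP[xk xj] := xs.
  have -> : c' x = c x by rewrite /c' swN ?if_same.
  rewrite /c'; case: ifP => _; last exact: uniqr.
  by move=> ec; apply: uniqr => //; rewrite -[c y]swK -ec swN.
exists c'; split=> [x y xQ yQ|x xQ|x xQ].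
- rewrite /adjacent_edges => /andP[ne /orP[/eqP e|/eqP e]]; apply: contraNneq ne => ce.
    apply/eqP; apply: uniql => //; move: ce; rewrite /c' e.
    by case: ifP => // _ /(can_inj swK).
  by apply/eqP; exact: cr.
- rewrite /c' /sw; have := cn x xQ; case: ifP => // _; case: ifP => // _.
  by case: ifP.
have swj y : sw (c y) = j -> c y = k.
  by move=> /(canRL swK) ->; rewrite /sw eqxx; case: eqP.
case/orP => /eqP e; rewrite /c'.
  have -> : C (inl x.1) by rewrite e /C connect0.
  by apply: contra (ka x xQ e) => /eqP /swj ->.
case: ifP => Cx; last exact: jb.
by apply/eqP => /swj ck; move: Cb0; rewrite -e -(Ck x xQ ck) Cx.
Qed.

(** Delete an edge [x0] and colour the rest. Each end of [x0] misses a colour, and a Kempe exchange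
    makes one colour free at both. *)
Theorem konig_edge_coloring (n : nat) (Q : {set A * B}) :
  (forall a, #|[set x in Q | x.1 == a]| <= n) ->
  (forall b, #|[set x in Q | x.2 == b]| <= n) ->
  exists2 c : A * B -> nat, proper_on Q c & forall x, x \in Q -> c x < n.
Proof.
have [k] := ubnP #|Q|; elim: k Q => // k IH Q Qk dA dB.
have [->|/set0Pn[x0 x0Q]] := eqVneq Q set0.
  by exists (fun=> 0) => [x y|x]; rewrite inE.
have sub (p : pred (A * B)) : #|[set x in Q :\ x0 | p x]| <= #|[set x in Q | p x]|.
  by apply: subset_leq_card; apply/subsetP => x; rewrite !inE => /andP[/andP[_ ->] ->].
have subS (p : pred (A * B)) : p x0 -> #|[set x in Q :\ x0 | p x]| < #|[set x in Q | p x]|.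
  move=> px0; apply: proper_card; apply/properP; split.
    by apply/subsetP => x; rewrite !inE => /andP[/andP[_ ->] ->].
  by exists x0; rewrite !inE ?x0Q ?px0 // eqxx.
have [|a|b|c cQ cn] := IH (Q :\ x0).
- by move: Qk; rewrite (cardsD1 x0) x0Q.
- exact: leq_trans (sub _) (dA a).
- exact: leq_trans (sub _) (dB b).
have [i iN ia] := missing_color c (leq_trans (subS (fun x => x.1 == x0.1) (eqxx _)) (dA x0.1)).
have [j jN jb] := missing_color c (leq_trans (subS (fun x => x.2 == x0.2) (eqxx _)) (dB x0.2)).
have [||c' [c'Q c'n c'j]] := kempe_swap (a0 := x0.1) (b0 := x0.2) cQ cn iN jN.
- by move=> x xQ /eqP e; apply: ia; rewrite !inE -in_setD1 xQ.
- by move=> x xQ /eqP e; apply: jb; rewrite !inE -in_setD1 xQ.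
have c'x0 x : x \in Q -> x != x0 -> adjacent_edges x x0 -> c' x != j.
  by move=> xQ xx0 /andP[_]; apply: c'j; rewrite !inE xx0.
exists (fun x => if x == x0 then j else c' x) => [x y xQ yQ xy|x xQ].
  have [ex|nx] := eqVneq x x0; have [ey|ny] := eqVneq y x0.
  - by move: xy; rewrite ex ey /adjacent_edges eqxx.
  - by rewrite eq_sym c'x0 // adjacent_edges_sym -ex.
  - by rewrite c'x0 // -ey.
  - by apply: c'Q; rewrite ?inE ?nx ?ny.
by have [//|nx] := eqVneq x x0; apply: c'n; rewrite !inE nx.
Qed.

(* [M] is a stable matching: each vertex prefers its edges of small weight. *)
Lemma stable_matching (wa wb : A * B -> nat) (Q : {set A * B}) :
  (forall x y, x \in Q -> y \in Q -> x.1 = y.1 -> wa x = wa y -> x = y) ->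
  (forall x y, x \in Q -> y \in Q -> x.2 = y.2 -> wb x = wb y -> x = y) ->
  exists M : {set A * B}, [/\ M \subset Q,
    {in M &, forall x y, ~~ adjacent_edges x y} &
    forall x, x \in Q -> x \notin M -> exists2 y, y \in M &
      (y.1 == x.1) && (wa y < wa x) || (y.2 == x.2) && (wb y < wb x)].
Proof.
have [k] := ubnP #|Q|; elim: k Q => // k IH Q Qk ia ib.
(* An edge is [top] if its end in [B] likes it best. If no two top edges meet in [A], they form the
   matching. Otherwise drop the worse one, [x], of two that do: it is dominated by the better one
   [y], or by the edge that dominates [y], which must do so in [A] because [y] is top. *)
pose top x := (x \in Q) && [forall y in Q, (y.2 == x.2) ==> (wb x <= wb y)].
have topP x y : top x -> y \in Q -> y.2 = x.2 -> wb x <= wb y.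
  by move=> /andP[_ /forall_inP h] yQ e; apply: (implyP (h y yQ)); rewrite e.
have [/forall_inP mt|] := boolP [forall x in Q, [forall y in Q,
    [&& top x, top y & x.1 == y.1] ==> (x == y)]].
  exists [set x in Q | top x]; split.
  - by apply/subsetP => x; rewrite inE => /andP[].
  - move=> x y; rewrite !inE => /andP[xQ tx] /andP[yQ ty]; apply/negP => /andP[ne].
    case/orP => /eqP e.
      have /forall_inP/(_ y yQ)/implyP := mt x xQ.
      by rewrite tx ty e eqxx (negPf ne) => /(_ isT).
    by case/eqP: ne; apply: ib => //; apply/eqP; rewrite eqn_leq !topP.
  move=> x xQ; rewrite inE xQ /= => ntx.
  have xp : (x \in Q) && (x.2 == x.2) by rewrite xQ eqxx.
  have [y /andP[yQ /eqP yx] ymin] :=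
    @arg_minnP _ x (fun z => (z \in Q) && (z.2 == x.2)) wb xp.
  have ty : top y.
    rewrite /top yQ; apply/forall_inP => z zQ; apply/implyP => /eqP zy.
    by apply: ymin; rewrite zQ zy yx eqxx.
  exists y; first by rewrite inE yQ.
  apply/orP; right; rewrite yx eqxx ltn_neqAle ymin // andbT.
  by apply: contraNneq ntx => e; rewrite -(ib y x).
move=> /forall_inPn[x xQ /forall_inPn[y yQ]].
rewrite negb_imply => /andP[/and3P[tx ty /eqP e] ne].
wlog lt : x y xQ yQ tx ty e ne / wa y < wa x => [wl|].
  have [lt|lt|eqw] := ltngtP (wa y) (wa x); first exact: (wl x y).
    by apply: (wl y x) => //; rewrite eq_sym.
  by case/eqP: ne; apply: ia.
have [|a b|a b|M [MQ Mm Md]] := IH (Q :\ x).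
- by move: Qk; rewrite (cardsD1 x) xQ.
- by rewrite !inE => /andP[_ aQ] /andP[_ bQ]; exact: ia.
- by rewrite !inE => /andP[_ aQ] /andP[_ bQ]; exact: ib.
exists M; split=> //; first exact: subset_trans MQ (subsetDl _ _).
move=> z zQ zM; have [->|zx] := eqVneq z x; last by apply: Md; rewrite // !inE zx.
have [yM|yM] := boolP (y \in M); first by exists y; rewrite // e eqxx lt.
have yQx : y \in Q :\ x by rewrite !inE yQ eq_sym ne.
have [w wM /orP[/andP[/eqP w1 w2]|/andP[/eqP w1 w2]]] := Md y yQx yM.
  by exists w; rewrite // w1 e eqxx (ltn_trans w2 lt).
have : w \in Q :\ x := subsetP MQ w wM; rewrite !inE => /andP[_ wQ].
by have := topP y w ty wQ w1; rewrite leqNgt w2.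
Qed.

(** Give a colour [g] to a stable matching [M] among the edges whose lists contain [g], and recurse.
    An edge that loses [g] from its list also loses a preferred edge to [M], so the strict
    inequality survives. Taking [g] from the list of some edge makes [M] nonempty. *)
Lemma galvin_list_coloring (C : finType) (c0 : C) (wa wb : A * B -> nat)
    (Q : {set A * B}) (L : A * B -> {set C}) :
  (forall x y, x \in Q -> y \in Q -> x.1 = y.1 -> wa x = wa y -> x = y) ->
  (forall x y, x \in Q -> y \in Q -> x.2 = y.2 -> wb x = wb y -> x = y) ->
  (forall x, x \in Q -> #|[set y in Q | (y.1 == x.1) && (wa y < wa x)]| +
     #|[set y in Q | (y.2 == x.2) && (wb y < wb x)]| < #|L x|) ->
  exists2 c : A * B -> C, proper_on Q c & forall x, x \in Q -> c x \in L x.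
Proof.
have [k] := ubnP #|Q|; elim: k Q L => // k IH Q L Qk ia ib LQ.
have [->|/set0Pn[x0 x0Q]] := eqVneq Q set0.
  by exists (fun=> c0) => [x y|x]; rewrite inE.
have [g gL] : exists g, g \in L x0.
  by apply/card_gt0P; apply: leq_trans (LQ x0 x0Q).
pose Qg := [set x in Q | g \in L x].
have sQg x : x \in Qg -> x \in Q by rewrite inE => /andP[].
have [x y xQ yQ|x y xQ yQ|M [MQ Mm Md]] := @stable_matching wa wb Qg.
- by apply: ia; exact: sQg.
- by apply: ib; exact: sQg.
have {}MQ x : x \in M -> x \in Q /\ g \in L x.
  by move=> /(subsetP MQ); rewrite inE => /andP.
have [y yM] : exists y, y \in M.
  have [x0M|x0M] := boolP (x0 \in M); first by exists x0.
  have [|y yM _] := Md x0 _ x0M; last by exists y.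
  by rewrite inE x0Q.
pose L' x := L x :\ g.
have sub (p : pred (A * B)) : #|[set x in Q :\: M | p x]| <= #|[set x in Q | p x]|.
  by apply: subset_leq_card; apply/subsetP => x; rewrite !inE => /andP[/andP[_ ->] ->].
have subS (p : pred (A * B)) z : z \in M -> p z ->
    #|[set x in Q :\: M | p x]| < #|[set x in Q | p x]|.
  move=> zM pz; apply: proper_card; apply/properP; split.
    by apply/subsetP => x; rewrite !inE => /andP[/andP[_ ->] ->].
  by exists z; rewrite !inE ?(MQ z zM).1 ?pz ?zM.
have [|a b|a b|x|c cQ cL] := IH (Q :\: M) L'.
- rewrite -ltnS; apply: leq_trans Qk; rewrite ltnS; apply: proper_card.
  apply/properP; split; first exact: subsetDl.
  by exists y; [exact: (MQ y yM).1|rewrite inE yM].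
- by rewrite !inE => /andP[_ aQ] /andP[_ bQ]; exact: ia.
- by rewrite !inE => /andP[_ aQ] /andP[_ bQ]; exact: ib.
- rewrite inE => /andP[xM xQ].
  have := LQ x xQ; rewrite (cardsD1 g (L x)) -/(L' x).
  have [gx|gx] := boolP (g \in L x); last first.
    by rewrite add0n; apply: leq_trans; rewrite ltnS leq_add ?sub.
  have [|z zM zd] := Md x _ xM; first by rewrite inE xQ.
  rewrite add1n ltnS; apply: leq_trans.
  case/orP: zd => zd.
    by rewrite -addSn leq_add ?sub // (subS _ z).
  by rewrite -addnS leq_add ?sub // (subS _ z).
exists (fun x => if x \in M then g else c x) => [x z xQ zQ xz|x xQ].
  case: ifP => xM; case: ifP => zM.
  - by have := Mm x z xM zM; rewrite xz.
  - by have := cL z; rewrite !inE zM zQ eq_sym => /(_ isT)/andP[].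
  - by have := cL x; rewrite !inE xM xQ => /(_ isT)/andP[].
  - by apply: cQ; rewrite // inE ?xM ?zM.
case: ifP => xM; first exact: (MQ x xM).2.
by have := cL x; rewrite !inE xM xQ => /(_ isT)/andP[].
Qed.

(* Each vertex of [B] orders its edges by a label that is bijective onto an
   initial segment; the labels below [i] form a Konig colouring, which keeps the
   number of edges of smaller label at a vertex of [A] below the label. *)
Lemma bipartite_list_coloring (C : finType) (c0 : C) (i : nat) (Q : {set A * B})
    (L : A * B -> {set C}) :
  (forall a, #|[set x in Q | x.1 == a]| <= i) ->
  (forall x, x \in Q -> i <= #|[set y in Q | y.2 == x.2]|) ->
  (forall x, x \in Q -> #|[set y in Q | y.2 == x.2]| <= #|L x|) ->
  exists2 c : A * B -> C, proper_on Q c & forall x, x \in Q -> c x \in L x.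
Proof.
move=> dA dB LQ.
pose star b := [set x in Q | x.2 == b].
pose idx x := index x (enum (star x.2)).
have idx_lt x : x \in Q -> idx x < #|star x.2|.
  by move=> xQ; rewrite cardE index_mem mem_enum inE xQ eqxx.
have idx_inj x y : x \in Q -> y \in Q -> x.2 = y.2 -> idx x = idx y -> x = y.
  move=> xQ yQ e; rewrite /idx e => h.
  have [xs ys] : x \in enum (star y.2) /\ y \in enum (star y.2).
    by rewrite !mem_enum !inE xQ yQ e eqxx.
  by rewrite -(nth_index x xs) h nth_index.
pose Q' := [set x in Q | idx x < i].
have [a|b|h hQ hi] := @konig_edge_coloring i Q'.
- apply: leq_trans (dA a); apply: subset_leq_card; apply/subsetP => x.
  by rewrite !inE => /andP[/andP[-> _] ->].
- apply: (card_le_inj_nat (f := idx)) => [x y|x]; last by rewrite !inE => /andP[/andP[]].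
  by rewrite !inE => /andP[/andP[xQ _] /eqP xb] /andP[/andP[yQ _] /eqP yb];
    apply: idx_inj; rewrite // xb yb.
(* Koenig colours replace the positions below [i] and lie below [i] themselves, so [q] is still
   injective on each star. *)
pose q x := if idx x < i then h x else idx x.
have q_lt x : x \in Q -> q x < #|star x.2|.
  move=> xQ; rewrite /q; case: ifP => xi; last exact: idx_lt.
  by apply: leq_trans (dB x xQ); apply: hi; rewrite inE xQ.
have q_proper x y : x \in Q -> y \in Q -> adjacent_edges x y ->
    q x < i -> q y < i -> q x != q y.
  move=> xQ yQ xy; rewrite /q; case: ifP => xi; case: ifP => yi.
  - by move=> _ _; apply: hQ; rewrite // inE ?xQ ?yQ.
  - by rewrite yi.
  - by rewrite xi.
  - by rewrite xi.
have q_inj x y : x \in Q -> y \in Q -> x.2 = y.2 -> q x = q y -> x = y.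
  move=> xQ yQ e qe; have [//|ne] := eqVneq x y.
  have xy : adjacent_edges x y by rewrite /adjacent_edges ne e eqxx orbT.
  have [xi|xi] := ltnP (idx x) i; have [yi|yi] := ltnP (idx y) i.
  - have := hQ x y; rewrite !inE xQ yQ xi yi => /(_ isT isT xy).
    by move: qe; rewrite /q xi yi => ->; rewrite eqxx.
  - by move: qe (hi x); rewrite /q xi ltnNge yi /= !inE xQ xi => -> /(_ isT); rewrite ltnNge yi.
  - by move: qe (hi y); rewrite /q yi ltnNge xi /= !inE yQ yi => <- /(_ isT); rewrite ltnNge xi.
  - by move: qe; rewrite /q !ltnNge xi yi /=; exact: idx_inj.
(* Vertices of [A] prefer small labels and vertices of [B] large ones, so the two counts add up to
   less than the star size. Labels from [i] on may repeat at a vertex of [A]; [enum_rank] breaks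
   these ties. *)
pose wa x := q x * #|B| + enum_rank x.2.
pose wb x := #|star x.2| - q x.
have wa_le x y : wa x < wa y -> q x <= q y.
  have [//|gt] := leqP (q x) (q y); rewrite /wa ltnNge => /negP[].
  apply: leq_trans _ (leq_addr _ _).
  apply: (@leq_trans ((q y).+1 * #|B|)); last by rewrite leq_mul2r gt orbT.
  by rewrite mulSn addnC leq_add2r ltnW.
apply: (galvin_list_coloring c0 (wa := wa) (wb := wb)) => [x y xQ yQ e|x y xQ yQ e|x xQ].
- rewrite /wa => w.
  have : (q x * #|B| + enum_rank x.2) %% #|B| = (q y * #|B| + enum_rank y.2) %% #|B| by rewrite w.
  rewrite !modnMDl !modn_small // => /val_inj/enum_rank_inj e2.
  by case: x y e e2 {xQ yQ w} => [? ?] [? ?] /= -> ->.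
- rewrite /wb e => w; apply: q_inj => //.
  move: w (q_lt x xQ) (q_lt y yQ); rewrite e.
  by move: (q x) (q y) #|star y.2| => a b d; lia.
have cb : #|[set y in Q | (y.2 == x.2) && (wb y < wb x)]| <= #|star x.2| - (q x).+1.
  apply: (card_le_inj_nat (f := fun y => q y - (q x).+1)) => [y z|y].
    rewrite !inE => /and3P[yQ /eqP ey] + /and3P[zQ /eqP ez].
    rewrite /wb ey ez => h1 h2 h3; apply: q_inj => //; first by rewrite ey ez.
    by move: (q x) (q y) (q z) #|star x.2| h1 h2 h3 => a b c d; lia.
  rewrite !inE => /and3P[yQ /eqP ey]; rewrite /wb ey.
  by have := q_lt y yQ; rewrite ey; move: (q x) (q y) #|star x.2| => a b d; lia.
have ca : #|[set y in Q | (y.1 == x.1) && (wa y < wa x)]| <= q x.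
  have nx y : wa y < wa x -> y != x by apply: contraTneq => ->; rewrite ltnn.
  have [xi|xi] := ltnP (q x) i.
    apply: (card_le_inj_nat (f := q)) => [y z|y].
      rewrite !inE => /and3P[yQ /eqP ey wy] /and3P[zQ /eqP ez wz] qe.
      apply/eqP; apply: contraT => ne.
      have yz : adjacent_edges y z by rewrite /adjacent_edges ne ey ez eqxx.
      have := q_proper y z yQ zQ yz (leq_ltn_trans (wa_le _ _ wy) xi)
        (leq_ltn_trans (wa_le _ _ wz) xi).
      by rewrite qe eqxx.
    rewrite !inE => /and3P[yQ /eqP ey wy]; have le := wa_le _ _ wy.
    rewrite ltn_neqAle le andbT; apply: q_proper => //.
      by rewrite /adjacent_edges nx // ey eqxx.
    exact: leq_ltn_trans le xi.
  apply: leq_trans _ xi; apply: leq_trans _ (dA x.1).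
  apply: subset_leq_card; apply/subsetP => y.
  by rewrite !inE => /and3P[-> ->].
apply: leq_trans (LQ x xQ); have := q_lt x xQ; rewrite -/(star x.2).
move: ca cb; move: (q x) #|star x.2|.
by move: #|_| #|_| => a b c d; lia.
Qed.

End Konig.

(** * Extending total colourings *)

(** Every nonempty induced subgraph has average degree below 6; the colouring argument uses
    planarity only in this form. *)
Definition sparse (T : finType) (e : rel T) : Prop :=
  forall W : {set T}, W != set0 ->
    \sum_(v in W) #|[set w in W | e v w]| < 6 * #|W|.

Section Extension.
Variables (T : finType) (k : nat).
Implicit Types (e : rel T) (X : {set T}) (Q : {set T * T}).

(** Colour [X] greedily: a vertex is constrained by its neighbours and its edges, at most twice its
    degree, and the choices do not interact because [X] is independent. *)
Lemma recolor_independent e X (cv : T -> nat) (ce : T -> T -> nat) :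
  (forall x y, x \in X -> e x y -> y \notin X) ->
  (forall x, x \in X -> 2 * deg e x < k) ->
  (forall v, v \notin X -> 1 <= cv v <= k) ->
  (forall u v, e u v -> 1 <= ce u v <= k /\ ce u v = ce v u) ->
  (forall u v, e u v -> u \notin X -> v \notin X -> cv u <> cv v) ->
  (forall u v w, e u v -> e u w -> v != w -> ce u v <> ce u w) ->
  (forall u v, e u v -> u \notin X -> ce u v <> cv u) ->
  symmetric e ->
  exists2 cv' : T -> nat, total_coloring [set: T] e k cv' ce &
    forall v, v \notin X -> cv' v = cv v.
Proof.
move=> Xind Xdeg cvk cek cvp cep cve es.
have /fin_all_exists[p pP] : forall x, exists c, x \in X ->
    [/\ 1 <= c <= k, forall y, e x y -> cv y <> c & forall y, e x y -> ce x y <> c].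
  move=> x; have [xX|_] := boolP (x \in X); last by exists 0.
  pose S : {set T + T} := [set inl y | y in [set y | e x y]] :|: [set inr y | y in [set y | e x y]].
  pose f (z : T + T) := match z with inl y => (cv y).-1 | inr y => (ce x y).-1 end.
  have Sk : #|S| < k.
    apply: leq_ltn_trans (Xdeg x xX); rewrite mul2n -addnn.
    by apply: leq_trans (leq_card_setU _ _) _; rewrite leq_add // leq_imset_card.
  have [c ck cS] := missing_color f Sk; exists c.+1 => _; split=> // y xy ec.
    have /cS : inl y \in S by rewrite inE imset_f // inE.
    by rewrite /f ec eqxx.
  have /cS : inr y \in S by rewrite inE (imset_f inr) ?orbT // inE.
  by rewrite /f ec eqxx.
exists (fun v => if v \in X then p v else cv v); last by move=> v /negPf->.
have ve u v : e u v -> ce u v <> if u \in X then p u else cv u.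
  by move=> uv; case: ifPn => [uX|]; [have [_ _ h] := pP u uX; exact: h|exact: cve].
split=> // [v _|u v uv|u v uv].
- by case: ifPn => [vX|]; [have [] := pP v vX|exact: cvk].
- case: ifPn => [uX|uX].
    by rewrite (negPf (Xind _ _ uX uv)); have [_ h _] := pP u uX; move/esym; exact: h.
  case: ifPn => [vX|vX]; last exact: cvp.
  by have [_ h _] := pP v vX; apply: h; rewrite es.
- split; first exact: ve.
  by rewrite (cek _ _ uv).2; apply: ve; rewrite es.
Qed.

Definition remove_edges e Q : rel T :=
  fun u v => [&& e u v, (u, v) \notin Q & (v, u) \notin Q].

Definition extendable e (VH : {set T}) (eH : rel T) cv ce : Prop :=
  exists (cv' : T -> nat) (ce' : T -> T -> nat),
    [/\ total_coloring [set: T] e k cv' ce',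
        (forall v, v \in VH -> cv' v = cv v) &
        (forall u v, eH u v -> ce' u v = ce u v)].

(** The vertices of [X] are recoloured last, so a deleted edge need only avoid the colour of its end
    outside [X] and the surviving edges at both ends. Pairs in [Q] are oriented away from [X]. *)
Lemma extend_edges e X Q (cv : T -> nat) (ce : T -> T -> nat) (c : T * T -> nat) :
  symmetric e ->
  (forall x y, x \in X -> e x y -> y \notin X) ->
  (forall x, x \in X -> 2 * deg e x < k) ->
  (forall x, x \in Q -> x.1 \in X /\ e x.1 x.2) ->
  total_coloring [set: T] (remove_edges e Q) k cv ce ->
  proper_on Q c ->
  (forall x, x \in Q -> [/\ 1 <= c x <= k, c x <> cv x.2,
    forall w, remove_edges e Q x.1 w -> c x <> ce x.1 w &
    forall w, remove_edges e Q x.2 w -> c x <> ce x.2 w]) ->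
  exists (cv' : T -> nat) (ce' : T -> T -> nat),
    [/\ total_coloring [set: T] e k cv' ce',
        (forall v, v \notin X -> cv' v = cv v) &
        (forall u v, u \notin X -> v \notin X -> ce' u v = ce u v)].
Proof.
move=> es Xind Xdeg QX [cvk cek cvp cep cve] cQ cA.
pose ce' u v := if (u, v) \in Q then c (u, v) else
  if (v, u) \in Q then c (v, u) else ce u v.
have Qn u v w : (u, v) \in Q -> (w, u) \notin Q.
  move=> uv; apply/negP => wu; have [wX ewu] := QX _ wu; have [uX _] := QX _ uv.
  by have := Xind _ _ wX ewu; rewrite uX.
have rs u v : remove_edges e Q u v -> remove_edges e Q v u.
  by rewrite /remove_edges es => /and3P[-> -> ->].
have ce'E u v : e u v -> [\/ (u, v) \in Q /\ ce' u v = c (u, v),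
    (v, u) \in Q /\ ce' u v = c (v, u) |
    remove_edges e Q u v /\ ce' u v = ce u v].
  rewrite /ce' /remove_edges => ->; case: ifPn => uv; first by constructor 1.
  by case: ifPn => vu; [constructor 2|constructor 3].
have ce's u v : e u v -> ce' u v = ce' v u.
  rewrite /ce' => uv; case: ifPn => uvQ; first by rewrite (negPf (Qn _ _ _ uvQ)).
  case: ifPn => // vuQ; apply: (cek _ _ _).2.
  by rewrite /remove_edges uv uvQ vuQ.
have [||v _|u v uv|u v uv uX vX|u v w uv uw vw|u v uv uX|//|cv' cvT cvX] :=
    @recolor_independent e X cv ce'.
- exact: Xind.
- exact: Xdeg.
- exact: cvk.
- split; last exact: ce's.
  have [[q ->]|[q ->]|[q ->]] := ce'E _ _ uv.
  + by have [] := cA _ q.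
  + by have [] := cA _ q.
  + by have [] := cek _ _ q.
- apply: cvp; rewrite /remove_edges uv /=.
  by apply/andP; split; apply/negP => /QX[/= xX _]; [rewrite xX in uX|rewrite xX in vX].
- have [[q ->]|[q ->]|[q ->]] := ce'E _ _ uv; have [[r ->]|[r ->]|[r ->]] := ce'E _ _ uw.
  + by apply/eqP; apply: cQ => //; rewrite /adjacent_edges xpair_eqE (negPf vw) andbF /= eqxx.
  + by have := Qn _ _ w q; rewrite r.
  + by have [_ _ h _] := cA _ q; exact: h.
  + by have := Qn _ _ v r; rewrite q.
  + by apply/eqP; apply: cQ => //; rewrite /adjacent_edges xpair_eqE (negPf vw) /= eqxx ?orbT.
  + by have [_ _ _ h] := cA _ q; exact: h.
  + by have [_ _ h _] := cA _ r; apply/nesym; exact: h.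
  + by have [_ _ _ h] := cA _ r; apply/nesym; exact: h.
  + exact: cep.
- have [[q ->]|[q ->]|[q ->]] := ce'E _ _ uv.
  + by have [] := QX _ q; rewrite /= (negPf uX).
  + by have [] := cA _ q.
  + by have [] := cve _ _ q.
exists cv', ce'; split=> // u v uX vX; rewrite /ce'.
case: ifPn => [/QX[/= h]|_]; first by rewrite h in uX.
by case: ifPn => [/QX[/= h]|_]; first by rewrite h in vX.
Qed.

Lemma deg_sub e e' v : (forall w, e' v w -> e v w) -> deg e' v <= deg e v.
Proof.
by move=> h; apply: subset_leq_card; apply/subsetP => w; rewrite !inE; exact: h.
Qed.

(** The edge [uv] must avoid at most [deg e u - 1] colours of edges at [u], [deg e v - 1] of edges
    at [v], and the colour of [v]: fewer than [k] in all. Then [u] is recoloured. *)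
Lemma extend_light_edge e (VH : {set T}) (eH : rel T) cv ce u v :
  symmetric e -> irreflexive e ->
  (forall a b, eH a b -> a \in VH /\ b \in VH) ->
  u \notin VH -> 2 * deg e u < k -> e u v -> deg e u + deg e v <= k ->
  extendable (remove_edges e [set (u, v)]) VH eH cv ce ->
  extendable e VH eH cv ce.
Proof.
move=> es ei eHV uV du uv duv [cv1 [ce1 [tc cvE ceE]]].
set e' := remove_edges e [set (u, v)] in tc.
pose S : {set T + option T} := [set inl y | y in [set y | e' u y]] :|:
  ([set inr (Some y) | y in [set y | e' v y]] :|: [set inr None]).
pose f (z : T + option T) := match z with inl y => (ce1 u y).-1
  | inr (Some y) => (ce1 v y).-1 | inr None => (cv1 v).-1 end.
have [vu uvne] : e v u /\ u != v.
  by rewrite es uv; split=> //; apply: contraTneq uv => ->; rewrite ei.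
have Sk : #|S| < k.
  apply: leq_trans duv.
  have d1 : deg e' u < deg e u.
    apply: proper_card; apply/properP; split.
      by apply/subsetP => w; rewrite !inE => /and3P[].
    by exists v; rewrite !inE // /e' /remove_edges !inE eqxx andbF.
  have d2 : deg e' v < deg e v.
    apply: proper_card; apply/properP; split.
      by apply/subsetP => w; rewrite !inE => /and3P[].
    by exists u; rewrite !inE // /e' /remove_edges !inE eqxx !andbF.
  have : #|S| <= deg e' u + (deg e' v + 1).
    apply: leq_trans (leq_card_setU _ _) _; apply: leq_add; first exact: leq_imset_card.
    apply: leq_trans (leq_card_setU _ _) _; rewrite cards1 leq_add2r.
    exact: leq_imset_card.
  by lia.
have [g gk gS] := missing_color f Sk.
have [|||||cv2 [ce2 [tc2 cv2E ce2E]]] := @extend_edges e [set u] [set (u, v)] cv1 ce1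
    (fun=> g.+1) es _ _ _ tc.
- by move=> x y /set1P -> uy; rewrite inE; apply: contraTneq uy => ->; rewrite ei.
- by move=> x /set1P ->.
- by move=> x /set1P -> /=; rewrite inE eqxx.
- by move=> x y /set1P -> /set1P ->; rewrite /adjacent_edges eqxx.
- move=> x /set1P -> /=; split=> // [ec|w uw ec|w vw ec].
  + have /gS : inr None \in S by rewrite !inE eqxx !orbT.
    by rewrite /f -ec eqxx.
  + have /gS : inl w \in S by rewrite inE (imset_f inl) // inE.
    by rewrite /f -ec eqxx.
  + have /gS : inr (Some w) \in S by rewrite !inE (imset_f (fun y => inr (Some y))) ?orbT // inE.
    by rewrite /f -ec eqxx.
exists cv2, ce2; split=> // [w wV|a b ab].
  by rewrite cv2E ?cvE // inE; apply: contraNneq uV => <-.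
have [aV bV] := eHV _ _ ab; rewrite ce2E ?ceE // inE.
  by apply: contraNneq uV => <-.
by apply: contraNneq uV => <-.
Qed.

(** If [m] edges at [b] are deleted, at most [deg e b - m + 1] colours are forbidden there, which
    leaves at least [m] because [deg e b < k]. At the ends in [X] no edge survives, so
    [bipartite_list_coloring] applies. *)
Lemma extend_light_stars e (VH : {set T}) (eH : rel T) cv ce i X :
  symmetric e ->
  (forall a b, eH a b -> a \in VH /\ b \in VH) ->
  (forall x, x \in X -> x \notin VH) ->
  (forall x y, x \in X -> e x y -> y \notin X) ->
  (forall x, x \in X -> deg e x <= i) -> 2 * i < k ->
  (forall v, deg e v < k) ->
  (forall x b, x \in X -> e x b -> i <= #|[set a in X | e a b]|) ->
  extendable (remove_edges e [set x | (x.1 \in X) && e x.1 x.2]) VH eH cv ce ->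
  extendable e VH eH cv ce.
Proof.
move=> es eHV XV Xind Xi ik dk Xb [cv1 [ce1 [tc cvE ceE]]].
set Q : {set T * T} := [set x | _] in tc; set e' := remove_edges e Q in tc.
have k0 : 0 < k by lia.
pose c0 := Ordinal k0.
pose L (x : T * T) : {set 'I_k} :=
  [set g : 'I_k | (cv1 x.2 != g.+1) && [forall w, e' x.2 w ==> (ce1 x.2 w != g.+1)]].
have QE x : (x \in Q) = (x.1 \in X) && e x.1 x.2 by rewrite inE.
have starE b : #|[set y in Q | y.2 == b]| = #|[set a in X | e a b]|.
  have inj : injective (fun a : T => (a, b)) by move=> a a' [].
  rewrite -[RHS](card_imset _ inj); apply: eq_card => -[a a'].
  rewrite !inE /=; apply/andP/imsetP => [[aX /eqP <-]|[z + [-> ->]]].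
    by exists a; rewrite ?inE.
  by rewrite inE eqxx.
have degE b : b \notin X -> deg e' b + #|[set a in X | e a b]| <= deg e b.
  move=> bX; rewrite /deg -cardsUI [X in _ + X](_ : _ = 0) ?addn0.
    apply: subset_leq_card; apply/subsetP => w; rewrite !inE.
    by case/orP => [/and3P[]|/andP[_]] //; rewrite es.
  apply: eq_card0 => w; rewrite !inE /e' /remove_edges !QE /=.
  by rewrite es; case: (w \in X); case: (e w b); rewrite ?andbF.
have Lk x : x \in Q -> #|[set y in Q | y.2 == x.2]| <= #|L x|.
  rewrite QE => /andP[xX x12]; rewrite starE.
  pose S : {set option T} := [set Some y | y in [set y | e' x.2 y]] :|: [set None].
  pose f (z : option T) := if z is Some y then (ce1 x.2 y).-1 else (cv1 x.2).-1.
  have LS : ~: L x \subset [set insubd c0 (f z) | z in S].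
    apply/subsetP => g; rewrite !inE negb_and negbK => gL.
    have fg z : f z = g -> g = insubd c0 (f z).
      by move=> ->; apply: val_inj; rewrite val_insubd ltn_ord.
    case/orP: gL => [/eqP ec|/forallPn[w]].
      by apply/imsetP; exists None; rewrite ?inE ?orbT //; apply: fg; rewrite /f ec.
    rewrite negb_imply negbK => /andP[xw /eqP ec].
    apply/imsetP; exists (Some w); last by apply: fg; rewrite /f ec.
    by rewrite inE imset_f // inE.
  have SL : #|~: L x| <= deg e' x.2 + 1.
    apply: leq_trans (subset_leq_card LS) _; apply: leq_trans (leq_imset_card _ _) _.
    apply: leq_trans (leq_card_setU _ _) _; rewrite cards1 leq_add2r.
    exact: leq_imset_card.
  have := cardsC (L x); rewrite card_ord; have := degE x.2 (Xind _ _ xX x12).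
  by have := dk x.2; move: SL; lia.
have [a|x|//|c cQ cL] := @bipartite_list_coloring _ _ _ c0 i Q L.
- have [aX|aX] := boolP (a \in X); last first.
    by rewrite eq_card0 // => x; rewrite !inE; apply: contraNF aX => /andP[/andP[h _] /eqP <-].
  have inj : injective (fun b : T => (a, b)) by move=> b b' [].
  apply: leq_trans (Xi a aX); rewrite /deg -[X in _ <= X](card_imset _ inj).
  apply: subset_leq_card; apply/subsetP => -[a' b]; rewrite !inE /=.
  by move=> /andP[/andP[_ ab] /eqP ea]; rewrite -ea; apply: imset_f; rewrite inE.
- by rewrite starE QE => /andP[xX x12]; exact: Xb x12.
have XX x w : x \in X -> ~~ e' x w.
  by move=> xX; rewrite /e' /remove_edges QE /= xX /=; case: (e x w).
have [x xX||||cvQ [ceQ [tcQ cvQE ceQE]]] :=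
    @extend_edges e X Q cv1 ce1 (fun x => (c x).+1) es Xind _ _ tc.
- by apply: leq_ltn_trans ik; rewrite leq_mul2l Xi.
- by move=> x; rewrite QE => /andP.
- by move=> x y xQ yQ xy; rewrite eqSS (inj_eq val_inj); exact: cQ.
- move=> x xQ; have := cL x xQ; rewrite inE => /andP[/eqP n1 /forallP n2].
  have := xQ; rewrite QE => /andP[xX _]; split.
  + by rewrite /= ltn_ord.
  + exact: nesym.
  + by move=> w; rewrite -/e' (negPf (XX _ _ xX)).
  + by move=> w xw; apply/nesym/eqP; exact: implyP (n2 w) xw.
exists cvQ, ceQ; split=> // [w wV|a b ab].
  by rewrite cvQE ?cvE //; apply: contraL wV; exact: XV.
have [aV bV] := eHV _ _ ab; rewrite ceQE ?ceE //.
  by apply: contraL aV; exact: XV.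
by apply: contraL bV; exact: XV.
Qed.

End Extension.

(** * Counting in graphs to which neither reduction applies *)

Section Counting.
Variables (T : finType) (e : rel T).

Definition neighbours (X : {set T}) : {set T} := [set b | [exists x in X, e x b]].

(** Delete from [X] all neighbours of [b]: at most [i] vertices go, and [b] leaves the neighbourhood
    for good. *)
Lemma card_peeling (i : nat) (X : {set T}) :
  (forall Y : {set T}, Y \subset X -> Y != set0 ->
     exists x b, [/\ x \in Y, e x b & #|[set a in Y | e a b]| <= i]) ->
  #|X| <= i * #|neighbours X|.
Proof.
have [n] := ubnP #|X|; elim: n X => // n IH X Xn hX.
have [->|X0] := eqVneq X set0; first by rewrite cards0.
have [x [b [xX xb bi]]] := hX X (subxx _) X0.
pose X' := [set a in X | ~~ e a b].
have X'X : X' \subset X by apply/subsetP => a; rewrite inE => /andP[].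
have cX : #|X| = #|X'| + #|[set a in X | e a b]|.
  rewrite -cardsUI [X in _ = _ + X](_ : _ = 0) ?addn0.
    apply: eq_card => a; rewrite !inE.
    by case: (a \in X); case: (e a b).
  by apply: eq_card0 => a; rewrite !inE; case: (e a b); rewrite ?andbF.
have X'n : #|X'| < n.
  rewrite -ltnS; apply: leq_trans Xn; rewrite ltnS; apply: proper_card.
  by apply/properP; split=> //; exists x; rewrite // inE xb andbF.
have nb : #|neighbours X'| < #|neighbours X|.
  apply: proper_card; apply/properP; split.
    apply/subsetP => c; rewrite !inE => /exists_inP[a aX' ac].
    by apply/exists_inP; exists a => //; exact: subsetP X'X a aX'.
  exists b; rewrite inE; first by apply/exists_inP; exists x.
  by apply/exists_inP => -[a]; rewrite inE => /andP[_ /negPf->].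
rewrite cX; apply: leq_trans (leq_add (IH X' X'n _) bi) _.
  by move=> Y YX'; apply: hX; exact: subset_trans X'X.
by rewrite addnC -mulnS leq_mul2l nb orbT.
Qed.

Lemma sparse_clique (K : {set T}) : sparse e ->
  (forall x y, x \in K -> y \in K -> x != y -> e x y) -> #|K| <= 6.
Proof.
move=> se cK; have [->|K0] := eqVneq K set0; first by rewrite cards0.
have := se K K0.
have : \sum_(x in K) #|K|.-1 <= \sum_(v in K) #|[set w in K | e v w]|.
  apply: leq_sum => x xK; rewrite (cardsD1 x) xK add1n /=.
  apply: subset_leq_card; apply/subsetP => y; rewrite !inE => /andP[yx yK].
  by rewrite yK cK // eq_sym.
rewrite sum_nat_const => le lt; have := leq_ltn_trans le lt.
by rewrite mulnC ltn_mul2r card_gt0 K0 /= => h; lia.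
Qed.

Variables (VH : {set T}) (eH : rel T) (k : nat).
Hypothesis es : symmetric e.
Hypothesis ei : irreflexive e.
Hypothesis se : sparse e.
Hypothesis HH : distance3_cliques e VH eH.
Hypothesis k28 : 28 <= k.

(** Neighbours of [v] in H are within distance 2 of each other, hence in one component, hence
    pairwise adjacent. *)
Lemma card_clique_neighbours v : #|[set w in VH | e v w]| <= 6.
Proof.
have [HE _ _ _ Hd] := HH; apply: sparse_clique => // x y.
rewrite !inE => /andP[xV vx] /andP[yV vy] xy.
have [/HE //|nxy] := boolP (eH x y).
by have [_ /(_ v)] := Hd x y xV yV xy nxy; rewrite es vx vy.
Qed.

(** [heavy] and [scattered] express the failure of the light edge reduction and of the star
    reduction. *)
Hypothesis heavy : forall u v, u \notin VH -> deg e u <= 13 -> e u v ->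
  k < deg e u + deg e v.
Hypothesis scattered : forall i (X : {set T}), 0 < i <= 5 -> X != set0 ->
  (forall x, x \in X -> [&& x \notin VH, 0 < deg e x & deg e x <= i]) ->
  exists x b, [/\ x \in X, e x b & #|[set a in X | e a b]| < i].

Lemma irreducible_edges u v : e u v -> eH u v.
Proof.
move=> uv; apply: contraT => nH; have [HE _ _ _ Hd] := HH.
have degP a b : e a b -> 0 < deg e a.
  by move=> ab; apply/card_gt0P; exists b; rewrite inE.
(* An edge outside H has an end outside H, since vertices of different components are not adjacent.
   This makes [W] below nonempty. *)
have [w0 w0V w0d] : exists2 w, w \notin VH & 0 < deg e w.
  have [uV|uV] := boolP (u \in VH); last by exists u => //; exact: degP uv.
  have [vV|vV] := boolP (v \in VH); last by exists v => //; apply: degP; rewrite es; exact: uv.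
  have ne : u != v by apply: contraTneq uv => ->; rewrite ei.
  by have [] := Hd u v uV vV ne nH; rewrite uv.
pose A i := [set v | [&& v \notin VH, 0 < deg e v & deg e v <= i]].
pose B := neighbours (A 5).
have cA i : 0 < i <= 5 -> #|A i| <= i.-1 * #|B|.
  move=> i5; apply: (@leq_trans (i.-1 * #|neighbours (A i)|)).
    apply: card_peeling => Y YA Y0.
    have [x xY|x [b [xY xb lt]]] := scattered i5 Y0.
      by have := subsetP YA x xY; rewrite inE.
    by exists x, b; split=> //; move: lt i5; lia.
  rewrite leq_mul2l subset_leq_card ?orbT //; apply/subsetP => b; rewrite !inE.
  move=> /exists_inP[a]; rewrite inE => /and3P[aV a0 ai] ab.
  by apply/exists_inP; exists a; rewrite // inE aV a0; move: ai i5; lia.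
have Bdeg b : b \in B -> 24 <= deg e b.
  rewrite inE => /exists_inP[a]; rewrite inE => /and3P[aV a0 ai] ab.
  have a13 : deg e a <= 13 by apply: leq_trans ai _.
  by have := heavy aV a13 ab; move: ai k28; lia.
(* Only isolated vertices and vertices of H of degree at most 13 are discarded, so a vertex loses at
   most 6 neighbours. A vertex outside H of degree at most 13 loses none: its neighbours have degree
   above [28 - 13]. *)
pose W := [set v | (0 < deg e v) && ~~ ((v \in VH) && (deg e v <= 13))].
have w0W : w0 \in W by rewrite inE w0d (negPf w0V).
pose d v := #|[set w in W | e v w]|.
have dW a b : e a b -> b \notin W -> b \in VH.
  rewrite es => ba; rewrite inE negb_and negbK (degP _ _ ba) /=.
  by case/andP.
have d6 a : deg e a <= d a + 6.
  apply: (@leq_trans (d a + #|[set w in VH | e a w]|)); last first.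
    by rewrite leq_add2l card_clique_neighbours.
  apply: leq_trans (leq_card_setU _ _); apply: subset_leq_card; apply/subsetP => b.
  rewrite inE => ab; rewrite !in_set ab !andbT.
  by have [//|/(dW _ _ ab)->] := boolP (b \in W); rewrite ?orbT // inE => ->.
have dlow a : a \notin VH -> deg e a <= 13 -> d a = deg e a.
  move=> aV a13; apply: eq_card => b; rewrite !in_set.
  case ab : (e a b); rewrite ?andbF // andbT.
  have ba : e b a by rewrite es.
  rewrite (degP _ _ ba) /=.
  have := heavy aV a13 ab => h; rewrite negb_and -ltnNge.
  by apply/orP; right; move: h k28 a13; lia.
(* Discharging: 6 minus the degree of a low vertex is its number of [A i]. *)
pose s a := (a \in A 1) + (a \in A 2) + (a \in A 3) + (a \in A 4) + (a \in A 5).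
(* A vertex of degree at least 14 keeps at least 8 neighbours, one in [B] at least
   [24 - 6 = 6 + 12]. A vertex outside H of degree [d <= 5] lies in [6 - d] of the sets [A i]. *)
have key a : a \in W -> 6 + 12 * (a \in B) <= d a + s a.
  move=> aW; have [a13|a13] := leqP (deg e a) 13; last first.
    have := d6 a; have [/Bdeg|_] := boolP (a \in B); first by move: a13; lia.
    by move: a13; lia.
  have aV : a \notin VH by move: aW; rewrite inE a13 andbT => /andP[].
  have a0 : 0 < deg e a by move: aW; rewrite inE => /andP[].
  have -> : a \in B = false by apply/negP => /Bdeg; move: a13; lia.
  rewrite dlow // /s !inE aV a0 /=.
  by move: a0; case: (deg e a) => [|[|[|[|[|[|]]]]]] //=; lia.
have sumB : \sum_(a in W) (6 + 12 * (a \in B)) = 6 * #|W| + 12 * #|B|.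
  rewrite big_split /= sum_nat_const mulnC -big_distrr /=; congr (_ + 12 * _).
  rewrite -big_mkcondr /= sum1_card; apply: eq_card => a.
  rewrite unfold_in /=; apply/andP/idP => [[] //|aB]; split=> //.
  by rewrite inE; have := Bdeg a aB; case: (a \in VH) => /=; lia.
have sumA i : \sum_(a in W) (a \in A i) <= #|A i|.
  rewrite -big_mkcondr /= sum1_card; apply: subset_leq_card.
  by apply/subsetP => a; rewrite unfold_in => /andP[].
have W0 : W != set0 by apply/set0Pn; exists w0.
(* The sizes of the [A i] add up to at most [(0 + 1 + 2 + 3 + 4) |B| = 10 |B|], which does not
   exceed the surplus [12 |B|], while sparsity is strict. *)
have : \sum_(a in W) d a < 6 * #|W| := se W0.
have : \sum_(a in W) (6 + 12 * (a \in B)) <= \sum_(a in W) (d a + s a).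
  by apply: leq_sum => a; exact: key.
rewrite sumB big_split /= /s !big_split /=.
have := sumA 1; have := sumA 2; have := sumA 3; have := sumA 4; have := sumA 5.
have := cA 1 isT; have := cA 2 isT; have := cA 3 isT; have := cA 4 isT; have := cA 5 isT.
by rewrite /=; lia.
Qed.

End Counting.

Lemma extend_precoloring (T : finType) (k : nat) (VH : {set T}) (eH : rel T) cv ce
    (e : rel T) :
  28 <= k -> symmetric e -> irreflexive e -> sparse e ->
  distance3_cliques e VH eH -> (forall v, deg e v < k) ->
  total_coloring VH eH k cv ce -> extendable k e VH eH cv ce.
Proof.
move=> k28 es ei se HH dk tc.
have [n] := ubnP #|[set x : T * T | e x.1 x.2 && ~~ eH x.1 x.2]|.
elim: n e es ei se HH dk => // n IH e es ei se HH dk en.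
have [HE HV Hs Ht Hd] := HH.
(* Deleted edges have an end outside H, so H survives, distances only grow, and sparsity and the
   degree bound are inherited. *)
have remove (Q : {set T * T}) : Q != set0 ->
    (forall x, x \in Q -> x.1 \notin VH /\ e x.1 x.2) ->
    extendable k (remove_edges e Q) VH eH cv ce.
  move=> /set0Pn[x0 x0Q] QV.
  have re u v : remove_edges e Q u v -> e u v by case/and3P.
  have eHQ u v : eH u v -> remove_edges e Q u v.
    move=> uv; have [uV vV] := HV _ _ uv; rewrite /remove_edges HE //=.
    by apply/andP; split; apply/negP => /QV[]; rewrite /= ?uV ?vV.
  apply: IH.
  - by move=> u v; rewrite /remove_edges es [X in _ && X]andbC.
  - by move=> u; rewrite /remove_edges ei.
  - move=> W W0; apply: leq_ltn_trans (se W W0); apply: leq_sum => v _.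
    apply: subset_leq_card; apply/subsetP => w; rewrite !inE => /andP[->].
    exact: re.
  - split=> // x y xV yV xy nxy; have [n1 n2] := Hd x y xV yV xy nxy.
    split=> [|w]; first by apply: contra n1; exact: re.
    by apply: contra (n2 w) => /andP[/re-> /re->].
  - by move=> v; apply: leq_ltn_trans (dk v); apply: deg_sub => w; exact: re.
  move: en; rewrite ltnS; apply: leq_trans; apply: proper_card; apply/properP; split.
    by apply/subsetP => x; rewrite !inE => /andP[/re-> ->].
  have [x0V x0e] := QV _ x0Q; exists x0; rewrite !inE ?x0e /=.
    by apply/negP => /HV[]; rewrite (negPf x0V).
  by rewrite /remove_edges -surjective_pairing x0Q andbF.
have [/existsP[u /existsP[v /and4P[uV ud uv duv]]]|light] := boolP [exists u, [exists v,
    [&& u \notin VH, deg e u <= 13, e u v & deg e u + deg e v <= k]]].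
  apply: (extend_light_edge es ei HV uV _ uv duv); first by move: ud k28; lia.
  apply: remove => [|x /set1P->] //.
  by apply/set0Pn; exists (u, v); rewrite inE.
have heavy u v : u \notin VH -> deg e u <= 13 -> e u v -> k < deg e u + deg e v.
  move=> uV ud uv; rewrite ltnNge; apply: contra light => le.
  by apply/existsP; exists u; apply/existsP; exists v; rewrite uV ud uv.
have [/existsP[[i i6] /existsP[X
    /and4P[/= i0 /set0Pn[x0 x0X] /forall_inP XP /forall_inP Xb]]]|sc] :=
  boolP [exists i : 'I_6, [exists X : {set T}, [&& 0 < i, X != set0,
    [forall x in X, [&& x \notin VH, 0 < deg e x & deg e x <= i]] &
    [forall x in X, [forall b, e x b ==> (i <= #|[set a in X | e a b]|)]]]]].
  have Xi x : x \in X -> deg e x <= i by case/XP/and3P.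
  apply: (@extend_light_stars _ _ e VH eH cv ce i X) => //.
  - by move=> x /XP/and3P[].
  - move=> x y xX xy; apply/negP => yX; have /and3P[xV _ xi] := XP x xX.
    have x13 : deg e x <= 13 by apply: leq_trans xi _; apply: ltnW; apply: leq_trans i6 _.
    by have := heavy x y xV x13 xy; move: xi (Xi y yX) i6 k28; lia.
  - by move: i6 k28; lia.
  - by move=> x b xX xb; have /forallP/(_ b)/implyP := Xb x xX; exact.
  apply: remove => [|x]; last by rewrite inE => /andP[/XP/and3P[-> _ _] ->].
  have /and3P[_ /card_gt0P[b x0b] _] := XP x0 x0X; rewrite inE in x0b.
  by apply/set0Pn; exists (x0, b); rewrite inE x0X.
have eE u v : e u v -> eH u v.
  apply: (irreducible_edges es ei se HH k28 heavy) => i X /andP[i0 i5] X0 XP.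
  have [/existsP[x /existsP[b /and3P[xX xb lt]]]|nx] := boolP [exists x, [exists b,
    [&& x \in X, e x b & #|[set a in X | e a b]| < i]]]; first by exists x, b.
  case/negP: sc; apply/existsP; exists (Ordinal (i5 : i < 6)); apply/existsP; exists X.
  rewrite /= i0 X0 /=; apply/andP; split; first by apply/forall_inP.
  apply/forall_inP => x xX; apply/forallP => b; apply/implyP => xb.
  rewrite leqNgt; apply: contra nx => lt.
  by apply/existsP; exists x; apply/existsP; exists b; rewrite xX xb lt.
have [tv te t1 t2 t3] := tc.
(* All edges now lie in H, so vertices outside H are isolated and can take the colour 1. *)
exists (fun v => if v \in VH then cv v else 1), ce; split=> // [|v -> //].
split=> [v _|u v /eE/te //|u v /eE uv|u v w /eE uv /eE uw|u v /eE uv].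
- by case: ifP => [/tv //|_]; lia.
- by have [-> ->] := HV _ _ uv; exact: t1.
- exact: t2.
- by have [-> ->] := HV _ _ uv; exact: t3.
Qed.

(** * Minors of the square grid *)

Definition grid_adj (n : nat) : rel ('I_n * 'I_n) := fun p q =>
  ((p.1 == q.1 :> nat) && ((p.2.+1 == q.2) || (q.2.+1 == p.2))) ||
  ((p.2 == q.2 :> nat) && ((p.1.+1 == q.1) || (q.1.+1 == p.1))).

Definition restrict_rel (T : Type) (r : rel T) (A : pred T) : rel T :=
  [rel x y | [&& r x y, A x & A y]].

(** Distance at most [d] in the maximum norm; the balls are squares. *)
Definition close_points (n d : nat) (p q : 'I_n * 'I_n) : bool :=
  [&& p.1 <= q.1 + d, q.1 <= p.1 + d, p.2 <= q.2 + d & q.2 <= p.2 + d].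

Lemma grid_adj_sym n : symmetric (@grid_adj n).
Proof.
move=> p q; rewrite /grid_adj; lia.
Qed.

Lemma restrict_rel_sym (T : Type) (r : rel T) (A : pred T) :
  symmetric r -> symmetric (restrict_rel r A).
Proof. by move=> rS x y; rewrite /restrict_rel /= rS [A x && _]andbC. Qed.

Lemma close_points_sym n d (p q : 'I_n * 'I_n) :
  close_points d p q = close_points d q p.
Proof. by rewrite /close_points; lia. Qed.

Lemma close_points_refl n d (p : 'I_n * 'I_n) : close_points d p p.
Proof. by rewrite /close_points; lia. Qed.

Lemma close_points_trans n d d' (q p r : 'I_n * 'I_n) :
  close_points d p q -> close_points d' q r -> close_points (d + d') p r.
Proof. by rewrite /close_points; lia. Qed.

Lemma close_points_weaken n d d' (p q : 'I_n * 'I_n) :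
  d <= d' -> close_points d p q -> close_points d' p q.
Proof. by rewrite /close_points; lia. Qed.

(** Induct on the l1 distance to the centre: a grid step towards [c] stays in the square. *)
Lemma ball_connect n d (c p : 'I_n.+1 * 'I_n.+1) :
  close_points d c p ->
  connect (restrict_rel (@grid_adj n.+1) (close_points d c)) c p.
Proof.
have [k] := ubnP (p.1 - c.1 + (c.1 - p.1) + (p.2 - c.2) + (c.2 - p.2)).
elim: k p => // k IH [p1 p2] /= lek cp.
have step (q : 'I_n.+1 * 'I_n.+1) :
    q.1 - c.1 + (c.1 - q.1) + (q.2 - c.2) + (c.2 - q.2) < k ->
    close_points d c q -> grid_adj q (p1, p2) ->
    connect (restrict_rel (@grid_adj n.+1) (close_points d c)) c (p1, p2).
  move=> qk cq qp; apply: connect_trans (IH q qk cq) (connect1 _).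
  by rewrite /restrict_rel /= qp cq.
have [c1 c2] : c.1 < n.+1 /\ c.2 < n.+1 by [].
move: cp (ltn_ord p1) (ltn_ord p2) => /= cp l1 l2.
have [e1|e1|e1] := ltngtP p1 c.1.
- have i1 : @inord n p1.+1 = p1.+1 :> nat by rewrite inordK; lia.
  apply: (step (inord p1.+1, p2)); move: cp; rewrite /close_points /grid_adj /= ?i1; lia.
- have i1 : @inord n p1.-1 = p1.-1 :> nat by rewrite inordK; lia.
  apply: (step (inord p1.-1, p2)); move: cp; rewrite /close_points /grid_adj /= ?i1; lia.
have [e2|e2|e2] := ltngtP p2 c.2.
- have i1 : @inord n p2.+1 = p2.+1 :> nat by rewrite inordK; lia.
  apply: (step (p1, inord p2.+1)); move: cp; rewrite /close_points /grid_adj /= ?i1; lia.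
- have i1 : @inord n p2.-1 = p2.-1 :> nat by rewrite inordK; lia.
  apply: (step (p1, inord p2.-1)); move: cp; rewrite /close_points /grid_adj /= ?i1; lia.
suff -> : (p1, p2) = c by exact: connect0.
by case: c {IH step cp lek c1 c2} e1 e2 => a b /= /val_inj -> /val_inj ->.
Qed.

(** Diagonal neighbours are joined through the corner [(b.1, a.2)], which is also within distance 1
    of [a]. *)
Lemma close1_connect n (A : pred ('I_n * 'I_n)) (a b : 'I_n * 'I_n) :
  close_points 1 a b -> (forall p, close_points 1 a p -> A p) ->
  connect (restrict_rel (@grid_adj n) A) a b.
Proof.
move=> ab cA; pose c := (b.1, a.2).
have st (x y : 'I_n * 'I_n) : close_points 1 x y ->
    (x.1 == y.1) || (x.2 == y.2) -> A x -> A y ->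
    connect (restrict_rel (@grid_adj n) A) x y.
  move=> cxy xy Ax Ay; have [->|nxy] := eqVneq x y; first exact: connect0.
  apply: connect1; rewrite /restrict_rel /= Ax Ay !andbT.
  move: cxy xy nxy; rewrite /close_points /grid_adj /=.
  case: x {Ax} => x1 x2; case: y {Ay} => y1 y2 /=.
  rewrite xpair_eqE -!val_eqE /=; lia.
have ac : close_points 1 a c by move: ab; rewrite /close_points /=; lia.
apply: (connect_trans (y := c)); apply: st => //; rewrite /c /= ?eqxx ?orbT //.
- exact/cA/close_points_refl.
- exact: cA.
- by move: ab; rewrite /close_points /=; lia.
- exact: cA.
- exact: cA.
Qed.

Lemma connect_component (T : finType) (r : rel T) (A : pred T) (x y : T) :
  A x -> connect (restrict_rel r A) x y ->
  connect (restrict_rel r [pred z | A z && connect (restrict_rel r A) x z]) x y.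
Proof.
move=> Ax /connectP[p + ->] {y}; elim/last_ind: p => [|p y IH] //=.
rewrite rcons_path last_rcons => /andP[pp ry].
have cl : connect (restrict_rel r A) x (last x p) by apply/connectP; exists p.
apply: connect_trans (IH pp) (connect1 _).
have cy := connect_trans cl (connect1 ry).
by move: ry cl cy; rewrite /restrict_rel /= => /and3P[-> -> ->] -> ->.
Qed.

(** [own] encodes disjoint branch sets, each connected to its [root], and each edge is realised by a
    grid edge between two of them. Staying off the border gives every owned point four
    neighbours. *)
Definition grid_minor (T : finType) (e : rel T) : Prop :=
  exists (n : nat) (own : 'I_n * 'I_n -> option T) (root : T -> 'I_n * 'I_n),
  [/\ forall u, own (root u) = Some u,
      forall p u, own p = Some u ->
        connect (restrict_rel (@grid_adj n) (fun x => own x == Some u)) (root u) p,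
      forall p, own p -> [&& 0 < p.1, 0 < p.2, p.1.+1 < n & p.2.+1 < n] &
      forall u v, e u v -> exists p q,
        [/\ grid_adj p q, own p = Some u & own q = Some v]].

(** * Even subgraphs and faces of a minor, over F_2 *)

Section GridMinors.
Import GRing.Theory.
Local Open Scope ring_scope.

(* Here [bool] is the field F_2: [+] is exclusive or. *)
Lemma addrr_bool (b : bool) : b + b = 0.
Proof. exact: addbb. Qed.

Lemma sum_bool_eq (I : finType) (A : pred I) (a : I) :
  \sum_(i | A i) (i == a) = A a :> bool.
Proof.
rewrite big_mkcond /=; have [Aa|nAa] := boolP (A a).
  by rewrite (bigD1 a) //= Aa eqxx big1 ?addr0 // => i /negPf->; rewrite if_same.
by apply: big1 => i _; case: eqP => [->|_]; rewrite ?(negPf nAa) ?if_same.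
Qed.

Lemma sum_bool_odd (I : finType) (A b : pred I) :
  \sum_(i | A i) b i = odd #|[pred i | A i && b i]| :> bool.
Proof.
rewrite -sum1_card (big_morph odd oddD (erefl _)) /= big_mkcondr /=.
by apply: eq_bigr => i _; case: (b i).
Qed.

Lemma sum_bool_sym (I : finType) (A : pred I) (g : I -> I -> bool) :
  (forall i j, g i j = g j i) -> (forall i, g i i = false) ->
  \sum_(i | A i) \sum_(j | A j) g i j = 0 :> bool.
Proof.
move=> gs g0; pose r (i : I) : nat := enum_rank i.
rewrite (eq_bigr (fun i => \sum_(j | A j && (r j < r i)%N) g i j +
    \sum_(j | A j && (r i < r j)%N) g i j)); last first.
  move=> i Ai; rewrite (bigID (fun j => (r j < r i)%N)) /=; congr (_ + _).
  rewrite (bigID (pred1 i)) /= big1 ?add0r; last by move=> j /andP[_ /eqP->].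
  apply: eq_bigl => j; rewrite -andbA; congr (_ && _).
  rewrite -leqNgt ltn_neqAle andbC eq_sym; congr (_ && _).
  by rewrite -(inj_eq enum_rank_inj).
rewrite big_split /= [X in _ + X](exchange_big_dep A) /=; last by move=> i j _ /andP[].
set x := (X in X + _); set y := (X in _ + X); suff -> : x = y by exact: addrr_bool.
apply: eq_bigr => i Ai; apply: eq_big => [j|j _]; last exact: gs.
by rewrite Ai.
Qed.

(** A path read as a 1-chain over F_2: its boundary is the sum of its ends. *)
Lemma connect_chain (P : finType) (r : rel P) (x y : P) :
  symmetric r -> connect r x y ->
  exists h : P -> P -> bool, [/\ (forall a b, h a b = h b a),
    (forall a b, h a b -> r a b) &
    forall a, \sum_b h a b = (a == x) + (a == y) :> bool].
Proof.
move=> rs /connectP[p + ->]; elim: p x => [|z p IH] x /=.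
  by exists (fun _ _ => false); split=> // a; rewrite big1 // addrr_bool.
case/andP=> xz /IH[h [hs hr hb]].
exists (fun a b => h a b + ((b == z) && (a == x) + (b == x) && (a == z))).
split=> [a b|a b|a].
- by rewrite hs (andbC (b == z)) (andbC (b == x)) [X in _ + X]addrC.
- case E : (h a b); first by move=> _; exact: hr.
  have [/andP[/eqP-> /eqP->] //|_] := boolP ((b == z) && (a == x)).
  by have [/andP[/eqP-> /eqP->] _|_] := boolP ((b == x) && (a == z)); rewrite // rs.
have sb (c d : P) : \sum_b ((b == c) && (a == d)) = (a == d).
  by rewrite -(big_distrl (a == d)) /= (sum_bool_eq xpredT) mul1r.
rewrite big_split /= hb big_split /= !sb.
by case: (a == x); case: (a == z); case: (a == last z p).
Qed.

Section PlanarMinor.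

(* A cellulation: [side p q] is the cell on the left of the edge from [p] to [q].
   [adj_turn] goes once round a point; [adj_bound] is the vanishing of the first
   homology over F_2. *)
Variables (P S : finType) (adj : rel P) (side : P -> P -> S) (inner : pred P).
Hypothesis adj_sym : symmetric adj.
Hypothesis adj_turn : forall p (f : S -> bool), inner p ->
  \sum_(q | adj p q) (f (side p q) + f (side q p)) = 0.
Hypothesis adj_bound : forall h : P -> P -> bool,
  (forall p q, h p q = h q p) ->
  (forall p q, h p q -> [&& adj p q, inner p & inner q]) ->
  (forall p, \sum_q h p q = 0) ->
  exists c : S -> bool,
    forall p q, adj p q -> c (side p q) + c (side q p) = h p q.

Variables (T : finType) (O : rel T) (own : P -> option T) (base : T -> P).
Hypothesis O_asym : forall u v, O u v -> (u != v) && ~~ O v u.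
Hypothesis own_conn : forall p u, own p = Some u ->
  connect (fun x y => [&& adj x y, own x == Some u & own y == Some u]) (base u) p.
Hypothesis own_inner : forall p, own p -> inner p.
Hypothesis own_link : forall u v, O u v ->
  exists p q, [/\ adj p q, own p = Some u & own q = Some v].

Let E := [set x : T * T | O x.1 x.2].

(** The boundary map over F_2: the parity of the degree of [u] in [z]. *)
Definition edge_degree (z : {set T * T}) (u : T) : bool :=
  \sum_(x in z) ((x.1 == u) + (x.2 == u)).

Lemma edge_link : exists l : T * T -> P * P, forall x, x \in E ->
  [/\ adj (l x).1 (l x).2, own (l x).1 = Some x.1 & own (l x).2 = Some x.2].
Proof.
suff /fin_all_exists : forall x, exists y : P * P, x \in E ->
  [/\ adj y.1 y.2, own y.1 = Some x.1 & own y.2 = Some x.2] by [].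
move=> [u v]; rewrite inE /=.
have [uv|] := boolP (O u v); last by exists (base u, base u).
by have [p [q pq]] := own_link uv; exists (p, q).
Qed.

(** These chains move odd points of a branch set to its base. *)
Lemma own_chain : exists ch : P -> P -> P -> bool,
  [/\ forall p a b, ch p a b = ch p b a,
      forall p a b, ch p a b -> [&& adj a b, own a & own a == own b] &
      forall p a, \sum_b ch p a b =
        if own p is Some u then (a == p) + (a == base u) else 0].
Proof.
have /fin_all_exists[ch chP] : forall p, exists h : P -> P -> bool,
  [/\ forall a b, h a b = h b a,
      forall a b, h a b -> [&& adj a b, own a & own a == own b] &
      forall a, \sum_b h a b =
        if own p is Some u then (a == p) + (a == base u) else 0].
  move=> p; case op : (own p) => [u|]; last first.
    by exists (fun _ _ => false); split=> // a; rewrite big1.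
  have rs : symmetric (fun x y => [&& adj x y, own x == Some u & own y == Some u]).
    by move=> x y; rewrite adj_sym [X in _ && X]andbC.
  have [h [hs hr hb]] := connect_chain rs (own_conn op).
  exists h; split=> // [a b /hr/and3P[-> /eqP-> /eqP->] //|a]; first by rewrite eqxx.
  by rewrite hb addrC.
by exists ch; split=> p; have [] := chP p.
Qed.

Variable l : T * T -> P * P.
Hypothesis lP : forall x, x \in E ->
  [/\ adj (l x).1 (l x).2, own (l x).1 = Some x.1 & own (l x).2 = Some x.2].

Let ls x := side (l x).1 (l x).2.
Let rs x := side (l x).2 (l x).1.

(** The edges of the cellulation that survive in the minor: those inside a branch set and the chosen
    links. Cells merge across all others. *)
Definition kept (p q : P) : bool := (own p && (own p == own q)) ||
  [exists x, (x \in E) && ((l x == (p, q)) || (l x == (q, p)))].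

Lemma kept_sym p q : kept p q = kept q p.
Proof.
rewrite /kept; congr (_ || _); last by apply: eq_existsb => x; rewrite [X in _ && X]orbC.
by apply/andP/andP => -[op /eqP e]; rewrite -e eqxx // e.
Qed.

(** Lift [z] to an even subgraph [h] of the cellulation: take the links of [z] and join every point
    where oddly many of them end to its base, inside the branch set. By [adj_bound], [h] bounds a
    set [c] of cells. Off the kept edges [h] vanishes, and on the links it records [z]. *)
Lemma even_lift (z : {set T * T}) : z \subset E ->
  (forall u, edge_degree z u = 0) ->
  exists c : S -> bool,
    (forall p q, adj p q -> ~~ kept p q -> c (side p q) = c (side q p)) /\
    (forall x, x \in E -> (x \in z) = c (ls x) + c (rs x)).
Proof.
move=> /subsetP zE zev; have [ch [chs cho chb]] := own_chain.
pose h0 p q : bool := \sum_(x in z) ((l x == (p, q)) + (l x == (q, p))).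
pose t p : bool := \sum_q h0 p q.
pose h p q : bool := h0 p q + \sum_a t a * ch a p q.
have h0s p q : h0 p q = h0 q p.
  by apply: eq_bigr => x _; rewrite addrC.
have h0E p q : h0 p q -> exists2 x, x \in z & (l x == (p, q)) || (l x == (q, p)).
  move=> h0pq; apply/exists_inP; apply: contraLR h0pq => /exists_inPn nz.
  rewrite /h0 big1 // => x /nz; rewrite negb_or => /andP[/negPf-> /negPf->].
  by rewrite addrr_bool.
have tE p : t p = \sum_(x in z) (((l x).1 == p) + ((l x).2 == p)).
  rewrite /t exchange_big /=; apply: eq_bigr => x _; rewrite big_split /=.
  case: (l x) => a b /=; congr (_ + _).
    rewrite (eq_bigr (fun q => (q == b) * (a == p))).
      by rewrite -big_distrl /= (sum_bool_eq xpredT) mul1r.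
    by move=> q _; rewrite xpair_eqE andbC (eq_sym b).
  rewrite (eq_bigr (fun q => (q == a) * (b == p))).
    by rewrite -big_distrl /= (sum_bool_eq xpredT) mul1r.
  by move=> q _; rewrite xpair_eqE (eq_sym a).
have h0adj p q : h0 p q -> [&& adj p q, own p & own q].
  move=> /h0E[x /zE/lP[a o1 o2]] /orP[] /eqP e; move: a o1 o2; rewrite e /=.
    by move=> -> -> ->.
  by rewrite adj_sym => -> -> ->.
have hs p q : h p q = h q p.
  by rewrite /h h0s; congr (_ + _); apply: eq_bigr => a _; rewrite chs.
have hch p q : ~~ [&& adj p q, own p & own p == own q] -> h p q = h0 p q.
  move=> n; rewrite /h big1 ?addr0 // => a _; apply/negbTE.
  by apply: contra n => /andP[_ /cho].
have hadj p q : h p q -> [&& adj p q, inner p & inner q].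
  have [/and3P[-> op /eqP e] _|n] := boolP [&& adj p q, own p & own p == own q].
    by rewrite !own_inner // -e.
  by rewrite hch // => /h0adj/and3P[-> /own_inner-> /own_inner->].
have hev p : \sum_q h p q = 0.
  rewrite /h big_split /= -/(t p) exchange_big /=.
  rewrite (eq_bigr (fun a => t a * (a == p) +
      (if own a is Some u then t a * (p == base u) else 0))); last first.
    move=> a _; rewrite -big_distrr /= chb.
    case oa : (own a) => [u|]; first by rewrite mulrDr (eq_sym p a).
    rewrite mulr0 addr0 tE big1 ?mul0r // => x /zE/lP[_ o1 o2].
    case: eqP => [e|_]; first by rewrite e oa in o1.
    by case: eqP => [e|_]; first by rewrite e oa in o2.
  rewrite big_split /= addrA.
  have -> : \sum_a t a * (a == p) = t p.
    rewrite (bigD1 p) //= eqxx mulr1 big1 ?addr0 // => a /negPf->.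
    by rewrite mulr0.
  rewrite addrr_bool add0r.
  (* Within a branch set the parities [t] add up to the degree of its vertex in [z], which is even,
     so the chains cancel at the base. *)
  rewrite (partition_big own xpredT) //=; apply: big1 => -[u|] _; last first.
    by apply: big1 => a /eqP->.
  rewrite (eq_bigr (fun a => t a * (p == base u))); last by move=> a /eqP->.
  rewrite -big_distrl /=.
  suff -> : \sum_(a | own a == Some u) t a = 0 by rewrite mul0r.
  rewrite (eq_bigr _ (fun a _ => tE a)) exchange_big /= -[RHS](zev u).
  apply: eq_bigr => x /zE/lP[_ o1 o2]; rewrite big_split /=.
  rewrite (eq_bigr (fun i => i == (l x).1)); last by move=> i _; rewrite eq_sym.
  rewrite (sum_bool_eq (fun a => own a == Some u)) o1; congr (_ + _).
  rewrite (eq_bigr (fun i => i == (l x).2)); last by move=> i _; rewrite eq_sym.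
  by rewrite (sum_bool_eq (fun a => own a == Some u)) o2.
have [c cP] := adj_bound hs hadj hev; exists c; split=> [p q pq|x xE].
  rewrite /kept /= => nk; apply/eqP; rewrite -subr_eq0; apply/eqP.
  rewrite -[RHS]/false (cP _ _ pq).
  move: nk; rewrite negb_or => /andP[n1 n2].
  rewrite hch; last by rewrite pq.
  apply: contraNF n2 => /h0E[x xz lx]; apply/existsP; exists x.
  by rewrite zE.
have [xadj o1 o2] := lP xE.
have x12 : x.1 != x.2 by move: xE; rewrite inE => /O_asym/andP[].
rewrite /ls /rs (cP _ _ xadj) hch; last first.
  by apply/negP => /and3P[_ _]; rewrite o1 o2 => /eqP[] e; rewrite e eqxx in x12.
rewrite /h0 -[LHS](sum_bool_eq (fun y => y \in z)) /=; apply: eq_bigr => y /zE yE.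
have [_ p1 p2] := lP yE.
have -> : l y == ((l x).1, (l x).2) = (y == x).
  apply/eqP/eqP => [e|->]; last by case: (l x).
  by move: p1 p2; rewrite e /= o1 o2 => -[e1] [e2]; case: (y) (x) e1 e2 => [? ?] [? ?] /= -> ->.
have -> : l y == ((l x).2, (l x).1) = false.
  apply/negP => /eqP e; move: p1 p2; rewrite e /= o1 o2 => -[e1] [e2].
  by move: yE xE; rewrite !inE -e1 -e2 => /O_asym/andP[_ /negPf->].
by rewrite addr0.
Qed.

(** The connected classes of this relation are the faces of the minor; [face] picks a representative
    cell. *)
Definition cell_adj : rel S := fun s s' =>
  [exists p, [exists q, [&& adj p q, ~~ kept p q, s == side p q & s' == side q p]]].

Let face s := fingraph.root cell_adj s.

Definition face_edges (f : S) : {set T * T} :=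
  [set x in E | (face (ls x) == f) != (face (rs x) == f)].

Lemma cell_adj_sym : symmetric cell_adj.
Proof.
suff imp s s' : cell_adj s s' -> cell_adj s' s by move=> s s'; apply/idP/idP; exact: imp.
move=> /existsP[p /existsP[q /and4P[a k es es']]].
by apply/existsP; exists q; apply/existsP; exists p; rewrite adj_sym a kept_sym k es es'.
Qed.

Lemma face_eq p q : adj p q -> ~~ kept p q -> face (side p q) = face (side q p).
Proof.
move=> pq nk; apply/eqP; rewrite root_connect; last first.
  exact: sym_connect_sym cell_adj_sym.
apply: connect1.
by apply/existsP; exists p; apply/existsP; exists q; rewrite pq nk !eqxx.
Qed.

Lemma face_const (c : S -> bool) :
  (forall p q, adj p q -> ~~ kept p q -> c (side p q) = c (side q p)) ->
  forall s, c (face s) = c s.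
Proof.
move=> cc s; have /connectP[p + e] := connect_root cell_adj s.
rewrite /face e {e}.
elim: p s => //= s' p IH s /andP[/existsP[a /existsP[b /and4P[ab nk /eqP-> /eqP->]]]].
by move=> /IH ->; rewrite (cc a b).
Qed.

(** Sum [adj_turn] for the indicator of [f] over the branch set of [u]. Edges inside it are counted
    from both ends and cancel; of those leaving it, only links of edges at [u] can have [f] on
    exactly one side. *)
Lemma face_edges_even f u :
  ~~ odd #|[set x in face_edges f | (x.1 == u) || (x.2 == u)]|.
Proof.
pose d p q : bool := (face (side p q) == f) + (face (side q p) == f).
have dK p q : adj p q -> d p q -> kept p q.
  by move=> pq; apply: contraLR => nk; rewrite /d (face_eq pq nk) addrr_bool.
pose X := [pred y : P * P | [&& own y.1 == Some u, adj y.1 y.2 & own y.2 != Some u] && d y.1 y.2].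
have X0 : odd #|X| = false.
  rewrite -sum_bool_odd -(pair_big_dep (fun p => own p == Some u)
    (fun p q => adj p q && (own q != Some u)) d) /=.
  have := @sum_bool_sym P (fun p => own p == Some u) (fun p q => adj p q && d p q).
  case/(_ _ _)/Wrap => [p q|p|sym0].
  - by rewrite adj_sym /d addrC.
  - by rewrite /d addrr_bool andbF.
  rewrite -[LHS]add0r -[X in X + _]sym0 -big_split /=.
  apply: big1 => p /eqP op.
  have ip : inner p by apply: own_inner; rewrite op.
  rewrite -[RHS](adj_turn (fun s => face s == f) ip).
  rewrite [RHS](bigID (fun q => own q == Some u)) /=; congr (_ + _).
  rewrite [RHS]big_mkcond [LHS]big_mkcond /=; apply: eq_bigr => q _.
  by case: (own q == Some u); case: (adj p q).
suff <- : #|X| = #|[set x in face_edges f | (x.1 == u) || (x.2 == u)]| by rewrite X0.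
pose phi (x : T * T) := if x.1 == u then l x else ((l x).2, (l x).1).
have phi_own x : x \in E -> (x.1 == u) || (x.2 == u) ->
    [/\ own (phi x).1 = Some u, adj (phi x).1 (phi x).2,
       own (phi x).2 = Some (if x.1 == u then x.2 else x.1) &
       own (phi x).2 != Some u].
  move=> xE; have [la o1 o2] := lP xE; rewrite /phi.
  move: xE; rewrite inE => /O_asym/andP[x12 _].
  case: eqP => [e _|ne /= /eqP e]; rewrite ?o1 ?o2 -?e /=.
    by split=> //; apply: contraNneq x12 => -[->].
  by rewrite adj_sym; split=> //; apply: contraNneq x12 => -[->].
have phi_inj : {in [set x in face_edges f | (x.1 == u) || (x.2 == u)] &, injective phi}.
  move=> x y; rewrite !inE => /andP[/andP[Ox _] xu] /andP[/andP[Oy _] yu] e.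
  have [xE yE] : x \in E /\ y \in E by rewrite !inE.
  have [_ _ + _] := phi_own x xE xu; have [_ _ + _] := phi_own y yE yu.
  rewrite e => -> [].
  move: Ox Oy xu yu; case: x {e xE} => a b; case: y {yE} => a' b' /=.
  have [-> | _] := eqVneq a u; have [-> | _] := eqVneq a' u => //= Ox Oy.
  - by move=> _ _ ->.
  - by move=> _ /eqP e ba; move: (O_asym Oy); rewrite e ba Ox andbF.
  - by move=> /eqP e _ ab; move: (O_asym Ox); rewrite e -ab Oy andbF.
  - by move=> /eqP-> /eqP-> ->.
rewrite -(card_in_imset phi_inj); apply: eq_card => y; rewrite [LHS]inE /=.
apply/idP/imsetP => [/andP[/and3P[/eqP o1 a o2] dy]|[x + ->]]; last first.
  rewrite !inE => /andP[/andP[Ox fx] xu].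
  have [|-> -> _ ->] := phi_own x _ xu; first by rewrite inE.
  rewrite eqxx /= /phi /d.
  move: fx; rewrite /ls /rs; case: (x.1 == u) => /=;
    by case: (_ == f); case: (_ == f).
have /orP[/andP[_ /eqP e]|/existsP[x /andP[xE lx]]] := dK _ _ a dy.
  by rewrite -e o1 eqxx in o2.
have [_ p1 p2] := lP xE.
have fx : x \in face_edges f.
  rewrite inE xE /ls /rs; move: dy; rewrite /d.
  by case/orP: lx => /eqP-> /=; case: (_ == f); case: (_ == f).
case/orP: lx => /eqP lx; move: p1 p2; rewrite lx /= o1.
  move=> [e] _; exists x; first by rewrite inE fx e eqxx.
  by rewrite /phi -e eqxx lx; case: (y).
move=> e1 [e2]; exists x; first by rewrite inE fx e2 eqxx orbT.
rewrite /phi lx; case: eqP => [e|_]; last by case: (y).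
by rewrite e1 e eqxx in o2.
Qed.

Lemma even_other (A : {set T * T}) x : x \in A -> ~~ odd #|A| ->
  exists2 y, y \in A & y != x.
Proof.
move=> xA; rewrite (cardsD1 x) xA /= negbK => oA.
have /card_gt0P[y] : (0 < #|A :\ x|)%N by case: (#|_|) oA.
by rewrite !inE => /andP[yx yA]; exists y.
Qed.

(** Even degrees give a second edge at either end of [x], and these two differ because there are no
    parallel edges. *)
Lemma face_edges_ge3 f : face_edges f != set0 -> (3 <= #|face_edges f|)%N.
Proof.
move=> /set0Pn[x xf].
have [] := @even_other [set y in face_edges f | (y.1 == x.1) || (y.2 == x.1)] x.
- by rewrite inE xf eqxx.
- exact: face_edges_even.
move=> y; rewrite inE => /andP[yf yx] y'x.
have [] := @even_other [set y in face_edges f | (y.1 == x.2) || (y.2 == x.2)] x.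
- by rewrite inE xf eqxx orbT.
- exact: face_edges_even.
move=> z; rewrite inE => /andP[zf zx] z'x.
have yz : y != z.
  apply: contraNneq y'x => yz; move: zx; rewrite -yz.
  have [Ox Oy] : O x.1 x.2 /\ O y.1 y.2.
    by move: xf yf; rewrite !inE => /andP[-> _] /andP[-> _].
  have /andP[/negPf x12 x21] := O_asym Ox.
  case/orP: yx => /eqP e1 /orP[] /eqP e2.
  - by rewrite -e1 -e2 eqxx in x12.
  - by case: (x) (y) e1 e2 => [? ?] [? ?] /= -> ->.
  - by rewrite -e1 -e2 Oy in x21.
  - by rewrite -e1 -e2 eqxx in x12.
have <- : #|[set x; y; z]| = 3%N.
  by rewrite -setUA cardsU1 !inE cards2 yz (eq_sym x y) (eq_sym x z) (negPf y'x) (negPf z'x).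
by apply: subset_leq_card; apply/subsetP => w; rewrite !in_setU !in_set1 -orbA => /or3P[] /eqP->.
Qed.

Lemma card_faces : (3 * #|[set f | face_edges f != set0]| <= 2 * #|E|)%N.
Proof.
rewrite mulnC -sum_nat_const.
apply: (@leq_trans (\sum_f #|face_edges f|)).
  rewrite [X in (_ <= X)%N](bigID (mem [set f | face_edges f != set0])) /=.
  apply: leq_trans (leq_addr _ _); apply: leq_sum => f; rewrite inE.
  exact: face_edges_ge3.
under eq_bigr => f _ do rewrite -sum1_card big_mkcond.
rewrite exchange_big /= mulnC -sum_nat_const [X in (_ <= X)%N]big_mkcond /=.
apply: leq_sum => x _; rewrite -big_mkcond sum1_card.
have [xE|nE] := boolP (x \in E).
  apply: leq_trans (_ : #|[set face (ls x); face (rs x)]| <= _)%N.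
    apply: subset_leq_card; apply/subsetP => f.
    rewrite unfold_in => xf; have : x \in face_edges f := xf.
    by rewrite in_set2 in_set !(eq_sym f); case: (_ == f); case: (_ == f); rewrite ?andbF.
  by rewrite cards2; case: (_ == _).
rewrite eq_card0 // => f; rewrite unfold_in; apply/negP => xf.
have : x \in face_edges f := xf.
by rewrite in_set (negPf nE).
Qed.

Let sd (z z' : {set T * T}) : {set T * T} := [set x | (x \in z) != (x \in z')].

Lemma edge_degreeD z z' u :
  edge_degree (sd z z') u = edge_degree z u + edge_degree z' u.
Proof.
rewrite /edge_degree !(big_mkcond (fun x => x \in _)) -big_split /=.
apply: eq_bigr => x _; rewrite inE.
by case: (x \in z); case: (x \in z'); rewrite ?addrr_bool ?addr0 ?add0r.
Qed.

Lemma sum_edge_degree z : \sum_u edge_degree z u = 0.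
Proof.
rewrite exchange_big /= big1 // => x _; rewrite big_split /=.
under eq_bigr => u _ do rewrite eq_sym.
under [X in _ + X]eq_bigr => u _ do rewrite eq_sym.
by rewrite !(sum_bool_eq xpredT) addrr_bool.
Qed.

Lemma even_face_set (z : {set T * T}) : z \subset E ->
  (forall u, edge_degree z u = 0) ->
  exists2 A : {set S}, A \subset [set f | face_edges f != set0] &
    forall x, x \in E -> (x \in z) = (face (ls x) \in A) + (face (rs x) \in A).
Proof.
move=> zE zev; have [c [cc cz]] := even_lift zE zev.
exists [set f | (face_edges f != set0) && c f].
  by apply/subsetP => f; rewrite !inE => /andP[].
move=> x xE; rewrite (cz x xE) -(face_const cc (ls x)) -(face_const cc (rs x)) !in_set.
have [->|lr] := eqVneq (face (ls x)) (face (rs x)); first by rewrite !addrr_bool.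
have -> : face_edges (face (ls x)) != set0.
  by apply/set0Pn; exists x; rewrite in_set xE eqxx [face (rs x) == _]eq_sym (negPf lr).
have -> // : face_edges (face (rs x)) != set0.
by apply/set0Pn; exists x; rewrite in_set xE eqxx (negPf lr).
Qed.

(** Euler's inequality by counting subsets [z] of [E]: each is determined by its odd vertices other
    than [w0] and a set of faces, so [2 ^ |E| <= 2 ^ (|W| - 1) * 2 ^ |F|]. With [3 |F| <= 2 |E|]
    this gives [|E| <= 3 |W| - 3]. *)
Lemma card_linked_edges (W : {set T}) : W != set0 ->
  (forall u v, O u v -> u \in W /\ v \in W) -> (#|E| < 3 * #|W|)%N.
Proof.
move=> /set0Pn[w0 w0W] OW.
pose F := [set f | face_edges f != set0].
have [fc fcP] : exists fc : {set T * T} -> {set S}, forall z, fc z \subset F /\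
    (z \subset E -> (forall u, edge_degree z u = 0) ->
     forall x, x \in E -> (x \in z) = (face (ls x) \in fc z) + (face (rs x) \in fc z)).
  suff /fin_all_exists : forall z : {set T * T}, exists A : {set S}, A \subset F /\
    (z \subset E -> (forall u, edge_degree z u = 0) ->
     forall x, x \in E -> (x \in z) = (face (ls x) \in A) + (face (rs x) \in A)) by [].
  move=> z; have [zE|nzE] := boolP (z \subset E); last first.
    by exists set0; split; rewrite ?sub0set.
  have [/forallP zev|nzev] := boolP [forall u, edge_degree z u == 0]; last first.
    exists set0; split; rewrite ?sub0set // => _ zev.
    by case/negP: nzev; apply/forallP => u; rewrite zev.
  have [A AF Az] := even_face_set zE (fun u => eqP (zev u)).
  by exists A.
(* The parity at [w0] is omitted because the handshake identity recovers it. [rep] fixes one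
   subgraph for each parity pattern; its symmetric difference with [z] is even. *)
pose code (z : {set T * T}) := [set u in W :\ w0 | edge_degree z u].
pose rep (A : {set T}) : {set T * T} :=
  odflt set0 [pick z : {set T * T} | (z \subset E) && (code z == A)].
have repP (z : {set T * T}) : z \subset E -> rep (code z) \subset E /\ code (rep (code z)) = code z.
  move=> zE; rewrite /rep; case: pickP => [z' /andP[z'E /eqP ->] //|/(_ z)].
  by rewrite zE eqxx.
have sdE (z z' : {set T * T}) : z \subset E -> z' \subset E -> sd z z' \subset E.
  move=> /subsetP zE /subsetP z'E; apply/subsetP => x; rewrite !in_set.
  have := zE x; have := z'E x; rewrite !in_set.
  by case: (x \in z) => [_ ->//|]; case: (x \in z') => // ->.
have code_even (z z' : {set T * T}) : z \subset E -> z' \subset E -> code z = code z' ->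
    forall u, edge_degree (sd z z') u = 0.
  move=> zE z'E /setP ezz.
  have dW u : u \notin W -> edge_degree (sd z z') u = 0.
    move=> uW; apply: big1 => x /(subsetP (sdE _ _ zE z'E)); rewrite in_set => /OW[x1 x2].
    have [n1 n2] : x.1 != u /\ x.2 != u by split; apply: contraNneq uW => <-.
    by rewrite (negPf n1) (negPf n2) addr0.
  have dN u : u != w0 -> edge_degree (sd z z') u = 0.
    move=> uw; have [uW|] := boolP (u \in W); last exact: dW.
    have := ezz u; rewrite !in_set !in_set1 uw uW edge_degreeD /= => ->; exact: addrr_bool.
  move=> u; have [->|] := eqVneq u w0; last exact: dN.
  have := sum_edge_degree (sd z z'); rewrite (bigD1 w0) //= big1 ?addr0 //.
pose phi (z : {set T * T}) := (code z, fc (sd z (rep (code z)))).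
have phi_inj : {in powerset E &, injective phi}.
  move=> z z'; rewrite !powersetE => zE z'E [ec ef]; rewrite -ec in ef.
  have [rE rc] := repP z zE; set r := rep (code z) in rE rc ef.
  have ev := code_even z r zE rE (esym rc).
  have ev' := code_even z' r z'E rE (etrans (esym ec) (esym rc)).
  apply/setP => x; have [xE|xE] := boolP (x \in E); last first.
    by rewrite (contraNF (subsetP zE x) xE) (contraNF (subsetP z'E x) xE).
  have e1 := (fcP (sd z r)).2 (sdE _ _ zE rE) ev x xE.
  have e2 := (fcP (sd z' r)).2 (sdE _ _ z'E rE) ev' x xE.
  move: e1 e2; rewrite -ef => <-; rewrite !in_set.
  by case: (x \in z); case: (x \in z'); case: (x \in r).
have : (#|powerset E| <= #|setX (powerset (W :\ w0)) (powerset F)|)%N.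
  rewrite -(card_in_imset phi_inj); apply: subset_leq_card.
  apply/subsetP => _ /imsetP[z _ ->]; rewrite in_setX !powersetE (fcP _).1 andbT.
  by apply/subsetP => u; rewrite in_set => /andP[].
rewrite cardsX !card_powerset -expnD leq_exp2l // => le.
have := card_faces; have := cardsD1 w0 W; rewrite w0W -/F.
move: le; move: #|E| #|W| #|F| #|W :\ w0| => a b c d; lia.
Qed.

End PlanarMinor.

(* Cell [(a, b)] has the point [(a, b)] as its upper right corner. *)
Definition grid_side (n : nat) (p q : 'I_n * 'I_n) : 'I_n.+1 * 'I_n.+1 :=
  (inord (p.1 + ((p.1 < q.1) || (q.2 < p.2)))%N,
   inord (p.2 + ((p.1 < q.1) || (p.2 < q.2)))%N).

Definition grid_inner (n : nat) : pred ('I_n * 'I_n) := fun p =>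
  [&& (0 < p.1)%N, (0 < p.2)%N, (p.1.+1 < n)%N & (p.2.+1 < n)%N].

(** * The square grid as a cellulation *)

Section Grid.
Variable m : nat.
Let n := m.+1.
Let pt (i j : nat) : 'I_n * 'I_n := (inord i, inord j).
Let sq (i j : nat) : 'I_n.+1 * 'I_n.+1 := (inord i, inord j).

Lemma grid_neighbours (p : 'I_n * 'I_n) (F : 'I_n * 'I_n -> bool) :
  grid_inner p ->
  \sum_(q | grid_adj p q) F q =
    F (pt p.1.+1 p.2) + F (pt p.1 p.2.+1) + F (pt p.1.-1 p.2) + F (pt p.1 p.2.-1).
Proof.
case: p => i j; rewrite /grid_inner /= => /and4P[i0 j0 iN jN].
have ptE a b (q : 'I_n * 'I_n) : (a < n)%N -> (b < n)%N ->
    (q == pt a b) = ((q.1 == a :> nat) && (q.2 == b :> nat)).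
  by move=> an bn; case: q => x y; rewrite xpair_eqE -!val_eqE /= !inordK.
have [lt1 [lt2 [lt3 lt4]]] : (i.+1 < n /\ j.+1 < n /\ i.-1 < n /\ j.-1 < n)%N by lia.
have pa a b : (a < n)%N -> (b < n)%N ->
  grid_adj (i, j) (pt a b) = ((i == a :> nat) && ((j.+1 == b) || (b.+1 == j)))
   || ((j == b :> nat) && ((i.+1 == a) || (a.+1 == i))).
  by move=> an bn; rewrite /grid_adj /= !inordK.
rewrite (bigD1 (pt i.+1 j)) /=; last by rewrite pa //; lia.
rewrite (bigD1 (pt i j.+1)) /=; last by rewrite pa // ptE //= !inordK //; lia.
rewrite (bigD1 (pt i.-1 j)) /=; last by rewrite pa // !ptE //= !inordK //; lia.
rewrite (bigD1 (pt i j.-1)) /=; last by rewrite pa // !ptE //= !inordK //; lia.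
rewrite big_pred0 ?addr0 ?addrA // => -[x y]; rewrite !ptE // /grid_adj /=.
by lia.
Qed.

(** Each of the four cells round [p] occurs twice, for two successive edges. *)
Lemma grid_turn (p : 'I_n * 'I_n) (f : 'I_n.+1 * 'I_n.+1 -> bool) :
  grid_inner p ->
  \sum_(q | grid_adj p q) (f (grid_side p q) + f (grid_side q p)) = 0.
Proof.
move=> pi; rewrite grid_neighbours //.
case: p pi => i j; rewrite /grid_inner /= => /and4P[i0 j0 iN jN].
have [lt1 [lt2 [lt3 lt4]]] : (i.+1 < n /\ j.+1 < n /\ i.-1 < n /\ j.-1 < n)%N by lia.
rewrite /grid_side /= !inordK //.
have -> : ((i < i.+1) = true)%N by lia.
have -> : ((i.+1 < i) = false)%N by lia.
have -> : ((j < j.+1) = true)%N by lia.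
have -> : ((j.+1 < j) = false)%N by lia.
have -> : ((i < i.-1) = false)%N by lia.
have -> : ((i.-1 < i) = true)%N by lia.
have -> : ((j < j.-1) = false)%N by lia.
have -> : ((j.-1 < j) = true)%N by lia.
rewrite !ltnn /= !addn0 !addn1 !prednK //.
by do 4 case: (f _).
Qed.

(** A cell belongs to [c] when the ray from it towards smaller first coordinates crosses [h] an odd
    number of times. Across an edge of [v] the claim is immediate; across an edge of [u] it follows
    by telescoping the evenness relation [vu] from the border. *)
Lemma grid_bound (h : 'I_n * 'I_n -> 'I_n * 'I_n -> bool) :
  (forall p q, h p q = h q p) ->
  (forall p q, h p q -> [&& grid_adj p q, grid_inner p & grid_inner q]) ->
  (forall p, \sum_q h p q = 0) ->
  exists c : 'I_n.+1 * 'I_n.+1 -> bool, forall p q, grid_adj p q ->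
    c (grid_side p q) + c (grid_side q p) = h p q.
Proof.
move=> hs hadj hev.
pose v i j : bool := [&& (i < n)%N, (j.+1 < n)%N & h (pt i j) (pt i j.+1)].
pose u i j : bool := [&& (i.+1 < n)%N, (j < n)%N & h (pt i j) (pt i.+1 j)].
(* Shifted by one to match the indices of the cells, and 0 at the border. *)
pose vv i b : bool := if b is j.+1 then v i j else 0.
pose uu a j : bool := if a is i.+1 then u i j else 0.
have vu i j : (i < n)%N -> (j < n)%N -> vv i j.+1 + vv i j = uu i.+1 j + uu i j.
  move=> iN jN; have := hev (pt i j).
  have [inn|nin] := boolP (grid_inner (pt i j)); last first.
    move=> _; have h0 q : h (pt i j) q = false.
      by apply: contraNF nin => /hadj/and3P[].
    have -> : vv i j.+1 = 0 by rewrite /vv /v h0 !andbF.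
    have -> : uu i.+1 j = 0 by rewrite /uu /u h0 !andbF.
    have -> : vv i j = 0 by case: (j) h0 => // b h0; rewrite /vv /v hs h0 !andbF.
    by case: (i) h0 => // a h0; rewrite /uu /u hs h0 !andbF.
  rewrite (bigID (fun q => grid_adj (pt i j) q)) /= [X in _ + X]big1 ?addr0; last first.
    by move=> q nq; apply: contraNF nq => /hadj/and3P[].
  rewrite grid_neighbours // /= !inordK //.
  move: inn; rewrite /grid_inner /= !inordK //.
  case: i j iN jN => [|i] [|j] iN jN //= /andP[iN' jN'].
  rewrite /v /u iN jN iN' jN' /= (hs (pt i j.+1)) (hs (pt i.+1 j)).
  by do 4 case: (h _ _).
pose c a b : bool := \sum_(0 <= i < a) vv i b.
have cv i j : (i < n)%N -> (j < n)%N -> c i.+1 j.+1 + c i j.+1 = v i j.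
  by move=> iN jN; rewrite /c big_nat_recr //= addrAC addrr_bool add0r.
have cu i j : (i < n)%N -> (j < n)%N -> c i.+1 j.+1 + c i.+1 j = u i j.
  move=> + jN; elim: i => [|i IH] iN; rewrite /c.
    by rewrite !big_nat1 vu // addr0.
  rewrite big_nat_recr //= [X in _ + X]big_nat_recr //= addrACA.
  by rewrite -/(c i.+1 j.+1) -/(c i.+1 j) IH ?(ltnW iN) // (vu i.+1) // addrCA addrr_bool addr0.
exists (fun s : 'I_n.+1 * 'I_n.+1 => c s.1 s.2) => p q pq.
have ptp (r : 'I_n * 'I_n) : pt r.1 r.2 = r.
  by case: r => a b; rewrite /pt !inord_val.
have half (p' q' : 'I_n * 'I_n) : grid_adj p' q' -> (p'.1 < q'.1)%N || (p'.2 < q'.2)%N ->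
    c (grid_side p' q').1 (grid_side p' q').2 +
    c (grid_side q' p').1 (grid_side q' p').2 = h p' q'.
  case: p' q' => [i j] [i' j']; rewrite /grid_adj /= => adj lt.
  have [ln [ln' [ln1 ln1']]] : (i < n /\ j < n /\ i' < n /\ j' < n)%N by rewrite !ltn_ord.
  rewrite /grid_side /=.
  have [[ei ej]|[ei ej]] :
      ((i' = i.+1 :> nat /\ j' = j :> nat) \/ (i' = i :> nat /\ j' = j.+1 :> nat))%N by lia.
    rewrite ei ej ltnSn ltnn ltnNge leqnSn /= !inordK ?addn0 ?addn1; try lia.
    rewrite cu // /u -ei ln1 ln' /= -[in RHS](ptp (i, j)) -[in RHS](ptp (i', j')) /=.
    by rewrite ej.
  rewrite ei ej ltnSn ltnn ltnNge leqnSn /= !inordK ?addn0 ?addn1; try lia.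
  rewrite addrC cv // /v -ej ln ln1' /= -[in RHS](ptp (i, j)) -[in RHS](ptp (i', j')) /=.
  by rewrite ei.
have [lt|nlt] := boolP ((p.1 < q.1)%N || (p.2 < q.2)%N); first exact: half.
rewrite addrC hs; apply: half; first by rewrite grid_adj_sym.
by move: pq nlt; rewrite /grid_adj; lia.
Qed.

End Grid.

Lemma grid_minor_edges (T : finType) (O : rel T) (W : {set T}) :
  (forall u v, O u v -> (u != v) && ~~ O v u) -> grid_minor O ->
  W != set0 -> (forall u v, O u v -> u \in W /\ v \in W) ->
  (#|[set x : T * T | O x.1 x.2]| < 3 * #|W|)%N.
Proof.
move=> Oas [[|m] [own [base [ob oc oi ol]]]] W0 OW.
  by case/set0Pn: W0 => w _; case: (base w) => -[].
have [l lP] := edge_link base ol.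
exact: (card_linked_edges (@grid_adj_sym m.+1) (@grid_turn m) (@grid_bound m)
  Oas oc oi lP W0 OW).
Qed.

End GridMinors.

(** * Digitising a planar drawing *)

Section Digitisation.
Import all_classical all_reals all_analysis Rstruct Rstruct_topology.
Import Order.TTheory GRing.Theory Num.Theory numFieldNormedType.Exports.
Local Open Scope classical_set_scope.
Local Open Scope ring_scope.

Lemma uniform_lower_bound (R : realType) (I : finType) (P : I -> R -> Prop) :
  (forall i, exists2 d : R, 0 < d & P i d) ->
  (forall i d d', 0 < d' -> d' <= d -> P i d -> P i d') ->
  exists2 d : R, 0 < d & forall i, P i d.
Proof.
move=> exP mono.
suff [d d0 Pd] : exists2 d : R, 0 < d & forall i, i \in enum I -> P i d.
  by exists d => // i; apply: Pd; rewrite mem_enum.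
elim: (enum I) => [|i s [d d0 IH]]; first by exists 1.
have [d' d'0 Pd'] := exP i.
have m0 : 0 < Num.min d d' by rewrite lt_min d0 d'0.
exists (Num.min d d') => // j; rewrite inE => /orP[/eqP->|js].
  by apply: mono Pd' => //; rewrite ge_min lexx orbT.
by apply: mono (IH j js) => //; rewrite ge_min lexx.
Qed.

Lemma continuous_pos_segment (R : realType) (f : R -> R) :
  continuous f -> (forall s : R, 0 <= s <= 1 -> 0 < f s) ->
  exists2 d : R, 0 < d & forall s : R, 0 <= s <= 1 -> d <= f s.
Proof.
move=> cf f0.
have [|c] := @EVT_min R f 0 1 ler01.
  exact: continuous_subspaceT.
rewrite in_itv/= => c01 fc; exists (f c); first exact: f0.
by move=> s s01; apply: fc; rewrite in_itv.
Qed.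

Lemma continuous_pos_square (R : realType) (f : R * R -> R) :
  continuous f ->
  (forall s t : R, 0 <= s <= 1 -> 0 <= t <= 1 -> 0 < f (s, t)) ->
  exists2 d : R, 0 < d &
    forall s t : R, 0 <= s <= 1 -> 0 <= t <= 1 -> d <= f (s, t).
Proof.
move=> cf f0.
have cS : compact (`[0, 1]%classic `*` `[0, 1]%classic : set (R * R)).
  by apply: compact_setX; exact: segment_compact.
have [||[a b]] := @compact_EVT_min _ R f _ _ cS.
- by exists (0, 0); split; rewrite /= in_itv/= lexx ler01.
- exact: continuous_subspaceT.
rewrite inE => -[/=]; rewrite !in_itv/= => a01 b01 fc.
exists (f (a, b)); first exact: f0.
by move=> s t s01 t01; apply: fc; rewrite inE; split; rewrite /= in_itv.
Qed.

(** The indicator of a locally constant [P] is continuous on the segment, and by the intermediate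
    value theorem it cannot jump over 1/2. *)
Lemma segment_induction (R : realType) (P : R -> Prop) :
  (forall s : R, 0 <= s <= 1 -> exists2 d : R, 0 < d & forall t : R, 0 <= t <= 1 ->
      `|t - s| < d -> (P s <-> P t)) ->
  P 0 -> P 1.
Proof.
move=> loc P0; apply: contrapT => nP1.
pose f (s : R) : R := if pselect (P s) then 1 else 0.
have f1 s : P s -> f s = 1 by rewrite /f; case: pselect.
have f0 s : ~ P s -> f s = 0 by rewrite /f; case: pselect.
have cf : {within `[0, 1]%classic, continuous f}.
  apply/subspace_continuousP => s /=; rewrite in_itv/= => s01.
  have [d d0 Ps] := loc s s01; apply: cvg_near_cst.
  rewrite near_withinE; apply: filterS (nbhsx_ballx s d d0) => t /= std.
  rewrite in_itv/= => t01; have ts : `|t - s| < d by rewrite distrC.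
  have [Pst Pts] := Ps t t01 ts.
  suff: f t = f s by [].
  have [ps|nps] := pselect (P s); first by rewrite (f1 _ ps) (f1 _ (Pst ps)).
  by rewrite (f0 _ nps) f0 // => pt; apply: nps; exact: Pts.
have [|c _] := @IVT R f 0 1 (1/2) ler01 cf.
  by rewrite (f1 _ P0) (f0 _ nP1) ge_min le_max; apply/andP; split; lra.
move=> fc; have [pc|npc] := pselect (P c).
  by move: fc; rewrite (f1 _ pc) => ?; lra.
by move: fc; rewrite (f0 _ npc) => ?; lra.
Qed.

Lemma truncn_lt_close (R : realType) (a b : R) (n : nat) : 0 <= a -> 0 <= b ->
  (Num.truncn a <= Num.truncn b + n)%N -> a - b < n.+1%:R.
Proof.
move=> a0 b0 ab.
have /andP[_ a2] := truncn_itv a0; have /andP[b1 _] := truncn_itv b0.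
have : (Num.truncn a).+1%:R <= (Num.truncn b + n).+1%:R :> R by rewrite ler_nat.
rewrite -addnS natrD => h; lra.
Qed.

Lemma truncn_le_close (R : realType) (a b : R) (n : nat) : 0 <= a -> 0 <= b ->
  a - b < n%:R -> (Num.truncn a <= Num.truncn b + n)%N.
Proof.
move=> a0 b0 ab.
have /andP[a1 _] := truncn_itv a0; have /andP[_ b2] := truncn_itv b0.
rewrite -ltnS -addSn -(ltr_nat R) natrD; lra.
Qed.

(* The plane is cut into cells of width [1 / sc]; the offset keeps the image of
   the square of radius [C] at distance at least [d] from the border of the
   grid. *)
Definition grid_size (R : realType) (sc C : R) (d : nat) : nat :=
  (Num.truncn (sc * (C + C)) + d + d + 2)%N.

Definition grid_round (R : realType) (sc C : R) (d : nat) (x : R * R) :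
    'I_(grid_size sc C d).+1 * 'I_(grid_size sc C d).+1 :=
  (inord (Num.truncn (sc * (x.1 + C)) + d.+1),
   inord (Num.truncn (sc * (x.2 + C)) + d.+1)).

(** * Rounding points of the plane to the grid *)

Section Rounding.
Variables (R : realType) (sc C : R) (d : nat).
Hypothesis sc0 : 0 < sc.

Let bnd (x : R) : `|x| <= C -> 0 <= sc * (x + C) <= sc * (C + C).
Proof.
rewrite ler_norml => /andP[x1 x2].
apply/andP; split; first by apply: mulr_ge0; [exact: ltW|lra].
by apply: ler_wpM2l; [exact: ltW|lra].
Qed.

Let trb (x : R) : `|x| <= C ->
  (Num.truncn (sc * (x + C)) <= Num.truncn (sc * (C + C)))%N.
Proof. by move=> /bnd/andP[_ h]; exact: le_truncn. Qed.

Let rd1 (x : R * R) : `|x| <= C ->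
  (grid_round sc C d x).1 = (Num.truncn (sc * (x.1 + C)) + d.+1)%N :> nat /\
  (grid_round sc C d x).2 = (Num.truncn (sc * (x.2 + C)) + d.+1)%N :> nat.
Proof.
rewrite prod_normE ge_max => /andP[/trb + /trb +].
rewrite /grid_round /grid_size /=.
move: (Num.truncn _) (Num.truncn _) (Num.truncn _) => a b c h1 h2.
by rewrite !inordK; lia.
Qed.

Lemma grid_round_interior x p k : `|x| <= C -> (k <= d)%N ->
  close_points k (grid_round sc C d x) p ->
  [/\ (0 < p.1)%N, (0 < p.2)%N, (p.1 < grid_size sc C d)%N
    & (p.2 < grid_size sc C d)%N].
Proof.
move=> xC kd; have [e1 e2] := rd1 xC; rewrite /close_points e1 e2.
move: xC; rewrite prod_normE ge_max => /andP[/trb + /trb +].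
move: (nat_of_ord p.1) (nat_of_ord p.2) => p1 p2; rewrite /grid_size.
by move: (Num.truncn _) (Num.truncn _) (Num.truncn _) => a b c *; split; lia.
Qed.

Lemma grid_round_lt x y k : `|x| <= C -> `|y| <= C ->
  close_points k (grid_round sc C d x) (grid_round sc C d y) ->
  sc * `|x - y| < k.+1%:R.
Proof.
move=> xC yC; have [e1 e2] := rd1 xC; have [f1 f2] := rd1 yC.
rewrite /close_points e1 e2 f1 f2 => cxy.
move: xC yC; rewrite !prod_normE !ge_max.
move=> /andP[/bnd/andP[x1 _] /bnd/andP[x2 _]] /andP[/bnd/andP[y1 _] /bnd/andP[y2 _]].
have lt a b : 0 <= sc * (a + C) -> 0 <= sc * (b + C) ->
    (Num.truncn (sc * (a + C)) <= Num.truncn (sc * (b + C)) + k)%N ->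
    (Num.truncn (sc * (b + C)) <= Num.truncn (sc * (a + C)) + k)%N ->
    sc * `|a - b| < k.+1%:R.
  move=> a0 b0 ab ba; rewrite -[X in X * _](gtr0_norm sc0) -normrM ltr_norml.
  have := truncn_lt_close a0 b0 ab; have := truncn_lt_close b0 a0 ba.
  by rewrite -!mulrBr => h1 h2; apply/andP; split; lra.
rewrite maxr_pMr ?ltW // gt_max.
by apply/andP; split; apply: lt => //; move: cxy;
  do 4 move: (Num.truncn _) => ?; lia.
Qed.

Lemma grid_round_close x y k : `|x| <= C -> `|y| <= C -> sc * `|x - y| < k%:R ->
  close_points k (grid_round sc C d x) (grid_round sc C d y).
Proof.
move=> xC yC; have [e1 e2] := rd1 xC; have [f1 f2] := rd1 yC.
rewrite /close_points e1 e2 f1 f2.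
move: xC yC; rewrite !prod_normE !ge_max.
move=> /andP[/bnd/andP[x1 _] /bnd/andP[x2 _]] /andP[/bnd/andP[y1 _] /bnd/andP[y2 _]].
rewrite maxr_pMr ?ltW // gt_max => /andP[h1 h2].
have lt a b : 0 <= sc * (a + C) -> 0 <= sc * (b + C) -> sc * `|a - b| < k%:R ->
    (Num.truncn (sc * (a + C)) <= Num.truncn (sc * (b + C)) + k)%N /\
    (Num.truncn (sc * (b + C)) <= Num.truncn (sc * (a + C)) + k)%N.
  move=> a0 b0; rewrite -[X in X * _](gtr0_norm sc0) -normrM ltr_norml.
  by move=> /andP[g1 g2]; split; apply: truncn_le_close => //; lra.
move: (lt _ _ x1 y1 h1) (lt _ _ x2 y2 h2).
by do 4 move: (Num.truncn _) => ?; lia.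
Qed.

End Rounding.

(** Boundedness is phrased with a factor [d] so that shrinking [d] weakens it, as
    [uniform_lower_bound] requires. *)
Lemma curve_bounded (R : realType) (g : R -> R * R) : continuous g ->
  exists2 d : R, 0 < d & forall s : R, 0 <= s <= 1 -> d * `|g s| <= 1.
Proof.
move=> cg.
have p0 s : 0 < 1 + `|g s| by rewrite ltr_pwDl.
have [||d d0 dg] := @continuous_pos_segment R (fun s => (1 + `|g s|)^-1).
- move=> s; apply: cvgV; first by rewrite gt_eqF // p0.
  by apply: cvgD; [exact: cvg_cst|apply: cvg_norm; exact: cg].
- by move=> s _; rewrite invr_gt0.
exists d => // s /dg dgs; have : d * (1 + `|g s|) <= 1.
  by rewrite -[leRHS](@mulVf _ (1 + `|g s|)) ?gt_eqF // ler_pM2r.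
by apply: le_trans; rewrite ler_pM2l // lerDr.
Qed.

Lemma curve_point_dist (R : realType) (g : R -> R * R) (x : R * R) :
  continuous g -> (forall s : R, 0 <= s <= 1 -> g s <> x) ->
  exists2 d : R, 0 < d & forall s : R, 0 <= s <= 1 -> d <= `|g s - x|.
Proof.
move=> cg gx; apply: continuous_pos_segment.
  by move=> s; apply: cvg_norm; apply: cvgB; [exact: cg|exact: cvg_cst].
by move=> s /gx gsx; rewrite normr_gt0 subr_eq0; apply/eqP.
Qed.

(** [pp a] is twice the positive part of [a]. The penalties make [f] positive where a curve is too
    near its excluded point and vanish on the pairs in question, so compactness of the whole square
    applies. *)
Lemma curve_curve_dist (R : realType) (g h : R -> R * R) (x y : R * R) (r : R) :
  continuous g -> continuous h ->
  (forall s t : R, 0 <= s <= 1 -> 0 <= t <= 1 -> r <= `|g s - x| ->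
     r <= `|h t - y| -> g s <> h t) ->
  exists2 d : R, 0 < d & forall s t : R, 0 <= s <= 1 -> 0 <= t <= 1 ->
     r <= `|g s - x| -> r <= `|h t - y| -> d <= `|g s - h t|.
Proof.
move=> cg ch gh.
pose pp (a : R) := a + `|a|.
pose f (z : R * R) :=
  `|g z.1 - h z.2| + (pp (r - `|g z.1 - x|) + pp (r - `|h z.2 - y|)).
have pp0 a : 0 <= pp a by rewrite -lerBlDl sub0r ler_normr lexx orbT.
have ppP a : 0 < a -> 0 < pp a by move=> a0; rewrite ltr_wpDr.
have ppN a : a <= 0 -> pp a = 0 by move=> a0; rewrite /pp ler0_norm ?subrr.
have cpp F (FF : Filter F) (k : R * R -> R) l :
    k z @[z --> F] --> l -> pp (k z) @[z --> F] --> pp l.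
  by move=> kl; apply: cvgD => //; exact: cvg_norm.
have [||d d0 df] := @continuous_pos_square R f.
- move=> z.
  have cg1 : g w.1 @[w --> z] --> g z.1.
    by apply: continuous_comp; [exact: cvg_fst|exact: cg].
  have ch2 : h w.2 @[w --> z] --> h z.2.
    by apply: continuous_comp; [exact: cvg_snd|exact: ch].
  apply: cvgD; first by apply: cvg_norm; apply: cvgB.
  apply: cvgD; apply: cpp; apply: cvgB; try exact: cvg_cst;
    by apply: cvg_norm; apply: cvgB => //; exact: cvg_cst.
- move=> s t s01 t01; rewrite /f /=.
  have [gr|gr] := ltrP `|g s - x| r.
    by rewrite ltr_wpDl // ltr_pwDl // ppP // subr_gt0.
  have [hr|hr] := ltrP `|h t - y| r.
    by rewrite ltr_wpDl // ltr_pwDr // ppP // subr_gt0.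
  apply: ltr_pwDl; last by rewrite addr_ge0.
  by rewrite normr_gt0 subr_eq0; apply/eqP; exact: gh.
exists d => // s t s01 t01 gr hr; have := df s t s01 t01.
by rewrite /f /= !ppN ?subr_le0 // !addr0.
Qed.

(** * Uniform distances in a planar drawing *)

Section Drawing.
Variables (R : realType) (T : finType) (O : rel T).
Variables (pos : T -> R * R) (g : T -> T -> R -> R * R).
Hypothesis pos_inj : injective pos.
Hypothesis gP : forall u v, O u v ->
  [/\ u != v, continuous (g u v), g u v 0 = pos u & g u v 1 = pos v].
Hypothesis g_pos : forall u v w (s : R), O u v -> 0 < s < 1 -> g u v s <> pos w.
Hypothesis g_disj : forall u v w x (s t : R), O u v -> O w x -> u != w ->
  0 < s < 1 -> 0 < t < 1 -> g u v s <> g w x t.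

Let itvP (s : R) : 0 <= s <= 1 -> [\/ s = 0, s = 1 | 0 < s < 1].
Proof.
move=> /andP[]; rewrite le_eqVlt => /predU1P[<- _|s0]; first by constructor 1.
rewrite le_eqVlt => /predU1P[->|s1]; first by constructor 2.
by constructor 3; rewrite s0.
Qed.

Lemma drawing_bound : exists2 C : R, 0 < C &
  (forall u, `|pos u| <= C) /\
  (forall u v (s : R), O u v -> 0 <= s <= 1 -> `|g u v s| <= C).
Proof.
have [|i d d' d'0 d'd h|d1 d10 h1] := @uniform_lower_bound R (T * T)%type
    (fun i d => O i.1 i.2 -> forall s : R, 0 <= s <= 1 -> d * `|g i.1 i.2 s| <= 1).
- move=> [u v] /=; have [uv|] := boolP (O u v); last by exists 1.
  by have [_ cg _ _] := gP uv; have [d d0 dP] := curve_bounded cg; exists d.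
- by move=> /h k s s01; apply: le_trans (k s s01); rewrite ler_wpM2r.
have [|u d d' d'0 d'd h|d2 d20 h2] := @uniform_lower_bound R T
    (fun u d => d * `|pos u| <= 1).
- move=> u; exists (1 + `|pos u|)^-1; first by rewrite invr_gt0 ltr_pwDl.
  by rewrite mulrC ler_pdivrMr ?ltr_pwDl // mul1r lerDr.
- by move: h => /=; apply: le_trans; rewrite ler_wpM2r.
exists (d1^-1 + d2^-1); first by rewrite addr_gt0 // invr_gt0.
have [e1 e2] : 0 < d1^-1 /\ 0 < d2^-1 by rewrite !invr_gt0.
split=> [u|u v s uv s01].
  have : `|pos u| <= d2^-1 by rewrite -[leRHS]mulr1 ler_pdivlMl //; exact: h2.
  by lra.
have : `|g u v s| <= d1^-1; last by lra.
by rewrite -[leRHS]mulr1 ler_pdivlMl //; exact: (h1 (u, v)).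
Qed.

(** The factor 5 leaves room for disjoint squares of radius [2 r] round the vertices and for
    rounding errors. *)
Lemma drawing_vertex_dist : exists2 r : R, 0 < r &
  (forall u w, u != w -> 5 * r <= `|pos u - pos w|) /\
  (forall u v w (s : R), O u v -> w != u -> w != v -> 0 <= s <= 1 ->
     5 * r <= `|g u v s - pos w|).
Proof.
have [|[[u v] w] d d' d'0 d'd h|d1 d10 h1] := @uniform_lower_bound R (T * T * T)%type
    (fun i d => O i.1.1 i.1.2 -> i.2 != i.1.1 -> i.2 != i.1.2 ->
       forall s : R, 0 <= s <= 1 -> d <= `|g i.1.1 i.1.2 s - pos i.2|).
- move=> [[u v] w] /=; have [uv|] := boolP (O u v); last by exists 1.
  have [wu|wu] := eqVneq w u; first by exists 1.
  have [wv|wv] := eqVneq w v; first by exists 1.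
  have [_ cg g0 g1] := gP uv.
  have [|d d0 dP] := @curve_point_dist R _ (pos w) cg; last by exists d.
  move=> s /itvP[->|->|s01]; last exact: g_pos.
    by rewrite g0 => /pos_inj e; rewrite e eqxx in wu.
  by rewrite g1 => /pos_inj e; rewrite e eqxx in wv.
- by move=> /= uv wu wv s s01; apply: le_trans d'd (h uv wu wv s s01).
have [|[u w] d d' d'0 d'd h|d2 d20 h2] := @uniform_lower_bound R (T * T)%type
    (fun i d => i.1 != i.2 -> d <= `|pos i.1 - pos i.2|).
- move=> [u w] /=; have [uw|uw] := eqVneq u w; first by exists 1.
  exists `|pos u - pos w| => //; rewrite normr_gt0 subr_eq0.
  by apply/eqP => /pos_inj e; rewrite e eqxx in uw.
- by move=> /= /h; exact: le_trans.
have m0 : 0 < Num.min d1 d2 by rewrite lt_min d10 d20.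
exists (Num.min d1 d2 / 5); first by rewrite divr_gt0.
have -> : 5 * (Num.min d1 d2 / 5) = Num.min d1 d2 by field.
split=> [u w uw|u v w s uv wu wv s01]; rewrite ge_min.
  by rewrite (h2 (u, w)) ?orbT.
by rewrite (h1 (u, v, w)).
Qed.

(** Curves with different starting vertices can meet only at a terminal vertex of one of them, and
    neighbourhoods of these are cut off. *)
Lemma drawing_curve_dist (r : R) : 0 < r -> exists2 d : R, 0 < d &
  forall u v w x (s t : R), O u v -> O w x -> u != w -> 0 <= s <= 1 -> 0 <= t <= 1 ->
    r <= `|g u v s - pos v| -> r <= `|g w x t - pos x| ->
    d <= `|g u v s - g w x t|.
Proof.
move=> r0.
have [|[[u v] [w x]] d d' d'0 d'd h|d1 d10 h1] :=
  @uniform_lower_bound R ((T * T) * (T * T))%type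
    (fun i d => O i.1.1 i.1.2 -> O i.2.1 i.2.2 -> i.1.1 != i.2.1 ->
      forall s t : R, 0 <= s <= 1 -> 0 <= t <= 1 ->
       r <= `|g i.1.1 i.1.2 s - pos i.1.2| ->
       r <= `|g i.2.1 i.2.2 t - pos i.2.2| ->
       d <= `|g i.1.1 i.1.2 s - g i.2.1 i.2.2 t|).
- move=> [[u v] [w x]] /=; have [uv|] := boolP (O u v); last by exists 1.
  have [wx|] := boolP (O w x); last by exists 1.
  have [uw|uw] := eqVneq u w; first by exists 1.
  have [_ cg g0 g1] := gP uv; have [_ ch h0 h1] := gP wx.
  have [|d d0 dP] := @curve_curve_dist R _ _ (pos v) (pos x) r cg ch; last by exists d.
  move=> s t /itvP[->|->|s01] /itvP[->|->|t01];
    rewrite ?g0 ?g1 ?h0 ?h1 ?subrr ?normr0 ?(lt_geF r0) // => _ _.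
  + by move=> /pos_inj e; rewrite e eqxx in uw.
  + by move/esym; exact: g_pos.
  + exact: g_pos.
  + exact: g_disj.
- move=> /= uv wx uw s t s01 t01 rs rt; apply: le_trans d'd _; exact: h.
exists d1 => // u v w x s t uv wx uw s01 t01; exact: (h1 ((u, v), (w, x))).
Qed.

End Drawing.

(** By continuity the rounded point moves by at most one cell in a short time, so it stays connected
    to the rounded start. *)
Lemma curve_grid_connect (R : realType) (sc C : R) (d : nat) (g : R -> R * R)
    (A : pred ('I_(grid_size sc C d).+1 * 'I_(grid_size sc C d).+1)) :
  0 < sc -> continuous g -> (forall s : R, 0 <= s <= 1 -> `|g s| <= C) ->
  (forall (s : R) p, 0 <= s <= 1 -> close_points 1 (grid_round sc C d (g s)) p -> A p) ->
  connect (restrict_rel (@grid_adj _) A) (grid_round sc C d (g 0)) (grid_round sc C d (g 1)).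
Proof.
move=> sc0 cg gC gA.
pose cn a b := connect (restrict_rel (@grid_adj _) A) (grid_round sc C d a) (grid_round sc C d b).
have cnC a b : cn a b = cn b a.
  by apply: sym_connect_sym; apply: restrict_rel_sym; exact: grid_adj_sym.
apply: (@segment_induction R (fun s => cn (g 0) (g s))); last exact: connect0.
move=> s s01.
have /cvgrPdist_lt /(_ _ _)/nbhs_ballP := cg s.
have sV : 0 < sc^-1 by rewrite invr_gt0.
move=> /(_ _ sV)[e /= e0 eP]; exists e => // t t01 ts.
have st : cn (g s) (g t).
  apply: close1_connect; last by move=> p; exact: gA.
  apply: grid_round_close; rewrite ?gC // mulrC -ltr_pdivlMr // div1r.
  by apply: eP; rewrite /ball /= distrC.
split=> h; first exact: connect_trans h st.
by apply: connect_trans h _; rewrite -/(cn _ _) cnC.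
Qed.

Lemma scaled_dist_contra (R : realFieldType) (sc r x : R) (k m : nat) :
  0 < sc -> sc * r = k%:R -> 5 * r <= x -> (m <= 5 * k)%N -> sc * x < m%:R -> False.
Proof.
move=> sc0 scr rx mk; apply/negP; rewrite -leNgt.
apply: le_trans (_ : (5 * k)%:R <= _); first by rewrite ler_nat.
by rewrite natrM -scr mulrCA ler_pM2l.
Qed.

Lemma drawing_grid_minor (R : realType) (T : finType) (O : rel T)
    (pos : T -> R * R) (g : T -> T -> R -> R * R) :
  injective pos ->
  (forall u v, O u v ->
     [/\ u != v, continuous (g u v), g u v 0 = pos u & g u v 1 = pos v]) ->
  (forall u v w (s : R), O u v -> 0 < s < 1 -> g u v s <> pos w) ->
  (forall u v w x (s t : R), O u v -> O w x -> u != w ->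
     0 < s < 1 -> 0 < t < 1 -> g u v s <> g w x t) ->
  grid_minor O.
Proof.
move=> pos_inj gP g_pos g_disj.
have [C C0 [posC gC]] := drawing_bound gP.
have [r r0 [rpos rg]] := drawing_vertex_dist pos_inj gP g_pos.
have [dl dl0 dlP] := drawing_curve_dist pos_inj gP g_pos g_disj r0.
(* [K] makes [sc * dl > 3]: points of two curves whose roundings are within 1 of a common grid point
   have scaled distance below 3. *)
have [K K0 KP] : exists2 K, (0 < K)%N & 3 * r / dl < K%:R.
  by exists (Num.truncn (3 * r / dl)).+1; rewrite ?truncnS_gt.
have [sc sc0 scr] : exists2 sc : R, 0 < sc & sc * r = K%:R.
  by exists (K%:R / r); rewrite ?divr_gt0 ?ltr0n // divfK // gt_eqF.
have scd : 3 < sc * dl.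
  by rewrite -(ltr_pM2r r0) mulrAC scr -ltr_pdivrMr.
pose rd := grid_round sc C (K + K).
set N := grid_size sc C (K + K) in rd *.
(* [u] owns the grid points near [pos u], and those near a curve from [u] to some
   [v] unless they are near [pos v]; thus only the end of a curve at [u] matters
   for the disjointness of the owned sets. *)
pose ball v p := close_points (K + K) (rd (pos v)) p.
pose near u v p := `[< exists2 s : R, 0 <= s <= 1 & close_points 1 (rd (g u v s)) p >].
pose allow u p := ball u p || [exists v, [&& O u v, near u v p & ~~ ball v p]].
have ballball u w p : ball u p -> ball w p -> u = w.
  rewrite /ball => pu; rewrite close_points_sym => pw.
  (* Squares of radius [2 K] that meet give a scaled distance below [4 K + 1 <= 5 K]. *)
  have := grid_round_lt sc0 (posC u) (posC w) (close_points_trans pu pw).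
  have [//|uw] := eqVneq u w; have ruw := rpos u w uw.
  by move=> /(scaled_dist_contra sc0 scr ruw); case; move: K0; clear; lia.
have ballnear u v w p : O u v -> near u v p -> ball w p -> w = u \/ w = v.
  rewrite /ball => uv /asboolP[s s01 sp]; rewrite close_points_sym => pw.
  have := grid_round_lt sc0 (gC u v s uv s01) (posC w) (close_points_trans sp pw).
  have [|wu] := eqVneq w u; first by left.
  have [|wv] := eqVneq w v; first by right.
  have ruw := rg u v w s uv wu wv s01.
  by move=> /(scaled_dist_contra sc0 scr ruw); case; move: K0; clear; lia.
have far u v s p : O u v -> 0 <= s <= 1 -> close_points 1 (rd (g u v s)) p ->
    ~~ ball v p -> r <= `|g u v s - pos v|.
  move=> uv s01 sp; apply: contraR; rewrite -ltNge -(ltr_pM2l sc0) scr => lt.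
  have := grid_round_close (K + K) sc0 (gC u v s uv s01) (posC v) lt.
  rewrite close_points_sym => /close_points_trans/(_ sp); apply: close_points_weaken.
  by move: K0; clear; lia.
have disj u w p : allow u p -> allow w p -> u = w.
  move=> /orP[bu|/existsP[v /and3P[uv nu bv]]] /orP[bw|/existsP[x /and3P[wx nw bx]]].
  - exact: ballball bu bw.
  - by have [//|ux] := ballnear _ _ _ _ wx nw bu; rewrite -ux bu in bx.
  - by have [//|wv] := ballnear _ _ _ _ uv nu bw; rewrite -wv bw in bv.
  have [//|uw] := eqVneq u w.
  have /asboolP[s s01 sp] := nu; have /asboolP[t t01 tp] := nw.
  have d1 := dlP _ _ _ _ s t uv wx uw s01 t01 (far _ _ _ _ uv s01 sp bv)
    (far _ _ _ _ wx t01 tp bx).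
  rewrite close_points_sym in tp.
  have lt := grid_round_lt sc0 (gC _ _ _ uv s01) (gC _ _ _ wx t01) (close_points_trans sp tp).
  by move: lt; rewrite ltNge (le_trans (ltW scd)) // ler_pM2l.
have interior u p : allow u p ->
    [&& (0 < p.1)%N, (0 < p.2)%N, (p.1.+1 < N.+1)%N & (p.2.+1 < N.+1)%N].
  move=> ap; have [x [k [xC kK xp]]] :
      exists x k, [/\ `|x| <= C, (k <= K + K)%N & close_points k (rd x) p].
    case/orP: ap => [bu|/existsP[v /and3P[uv /asboolP[s s01 sp] _]]].
      by exists (pos u), (K + K)%N.
    exists (g u v s), 1%N; split=> //; first exact: gC.
    by move: K0; clear; lia.
  by have [i1 i2 i3 i4] := grid_round_interior sc0 xC kK xp; rewrite i1 i2 !ltnS i3.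
pose root u := rd (pos u).
have allow_root u : allow u (root u) by rewrite /allow /ball close_points_refl.
(* The allowed set need not be connected; [u] owns only the component of its root. *)
pose comp u p := allow u p && connect (restrict_rel (@grid_adj _) (allow u)) (root u) p.
pose own p := [pick u | comp u p].
have ownE p u : (own p == Some u) = comp u p.
  rewrite /own; case: pickP => [w cw|/(_ u) -> //].
  apply/eqP/idP => [[<-] //|cu]; congr Some.
  by move: cw cu => /andP[aw _] /andP[au _]; exact: disj aw au.
have comp_root u : comp u (root u) by rewrite /comp allow_root connect0.
have comp_ball u p : ball u p -> comp u p.
  move=> bu; rewrite /comp /allow bu /=.
  apply: connect_sub (ball_connect bu) => x y /and3P[xy bx by_].
  by apply: connect1; rewrite /restrict_rel /= xy /allow -!/(ball _ _) /ball bx by_.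
exists N.+1, own, root; split=> [u|p u||u v uv].
- by apply/eqP; rewrite ownE.
- move/eqP; rewrite ownE => /andP[ap cp].
  rewrite (@eq_connect _ _ (restrict_rel (@grid_adj _) (comp u))).
    exact: connect_component.
  by move=> x y; rewrite /restrict_rel /= !ownE.
- move=> p; case e : (own p) => [u|//] _; move/eqP: e.
  by rewrite ownE => /andP[/interior].
have [uv' cg g0 g1] := gP u v uv.
have cn : connect (restrict_rel (@grid_adj _) (near u v)) (root u) (root v).
  rewrite /root -g0 -g1; apply: (curve_grid_connect sc0 cg).
    by move=> s s01; exact: gC.
  by move=> s p s01 sp; apply/asboolP; exists s.
(* Follow the rounded curve from [root u]. Without a link it never enters the square round [pos v],
   all of which [v] owns, so it stays in the component of [u] as far as [root v], which is
   absurd. *)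
apply: contrapT => nolink.
have nl p q : grid_adj p q -> comp u p -> ~~ comp v q.
  move=> pq cp; apply/negP => cq; apply: nolink; exists p, q.
  by split=> //; apply/eqP; rewrite ownE.
suff /andP[av _] : comp u (root v).
  by move: uv'; rewrite (disj _ _ _ av (allow_root v)) eqxx.
case/connectP: cn => p + ->; move: (comp_root u).
elim: p (root u) => //= y p IH x cx /andP[/and3P[xy _ ny]]; apply: IH.
have bv : ~~ ball v y by apply: contra (nl _ _ xy cx); exact: comp_ball.
have ay : allow u y by apply/orP; right; apply/existsP; exists v; rewrite uv ny.
move: cx; rewrite /comp => /andP[ax cx]; rewrite ay.
by apply: connect_trans cx (connect1 _); rewrite /restrict_rel /= xy ax ay.
Qed.

End Digitisation.

(** * Sparsity of planar graphs, and the extension theorem *)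

Section PlanarSparsity.
Import all_classical all_reals all_analysis Rstruct Rstruct_topology.

(** Orienting the edges inside [W] by [enum_rank] selects one of the two curves of each. Oriented
    edges with different first ends are then different edges, so their open curves are disjoint. The
    degree sum is twice the number of oriented edges. *)
Lemma planar_sparse (T : finType) (e : rel T) :
  symmetric e -> irreflexive e -> planar e -> sparse e.
Proof.
move=> es ei [pos [g [pos_inj [gP gD]]]] W W0.
pose O u v := [&& e u v, u \in W, v \in W & enum_rank u < enum_rank v].
have Oas u v : O u v -> (u != v) && ~~ O v u.
  move=> /and4P[_ _ _ uv]; apply/andP; split.
    by apply: contraTneq uv => ->; rewrite ssrnat.ltnn.
  by apply/negP => /and4P[_ _ _]; rewrite ltnNge ltnW.
have gm : grid_minor O.
  apply: (@drawing_grid_minor Rdefinitions.R T O pos g pos_inj).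
  - move=> u v uv; have /andP[ne _] := Oas _ _ uv; move/and4P: uv => [/gP[cg g0 g1 _ _] _ _ _].
    by split.
  - by move=> u v w s /and4P[/gP[_ _ _ _ gw] _ _ _]; exact: gw.
  move=> u v w x s t uv wx uw; apply: gD.
  - by case/and4P: uv.
  - by case/and4P: wx.
  apply/eqP => /setP sE; have /andP[_ /negP] := Oas _ _ uv; apply.
  have := sE u; have := sE w; rewrite !inE !eqxx /=.
  rewrite (eq_sym w u) (negPf uw) /= => /eqP wv /esym /eqP ux.
  by rewrite -wv ux in wx *.
have OW u v : O u v -> u \in W /\ v \in W by case/and4P.
have lt := grid_minor_edges Oas gm W0 OW.
suff -> : \sum_(v in W) #|[set w in W | e v w]| = 2 * #|[set x : T * T | O x.1 x.2]| by lia.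
have c2 : #|[set x : T * T | O x.2 x.1]| = #|[set x : T * T | O x.1 x.2]|.
  have swI : injective (fun x : T * T => (x.2, x.1)) by move=> [a b] [c d] [-> ->].
  rewrite -[RHS](card_imset _ swI); apply: eq_card => -[a b].
  apply/idP/imsetP => [ab|[[c d] + [-> ->]]]; rewrite ?inE //.
  by exists (b, a); rewrite // inE; move: ab; rewrite inE.
rewrite mul2n -addnn -{1}c2 -!sum1_card.
rewrite (eq_bigr (fun v => \sum_(w in W | e v w) 1)); last first.
  by move=> v _; rewrite -sum1_card; apply: eq_bigl => w; rewrite inE.
rewrite pair_big_dep /= (bigID (fun x : T * T => enum_rank x.2 < enum_rank x.1)) /=.
congr (_ + _); apply: eq_bigl => -[a b]; rewrite inE /O /=.
  by rewrite es; case: (a \in W); case: (b \in W); case: (e b a).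
have [->|ab] := eqVneq a b; first by rewrite ei !andbF.
rewrite -leqNgt leq_eqVlt (inj_eq val_inj) (inj_eq enum_rank_inj) (negPf ab) /=.
by case: (a \in W); case: (b \in W); case: (e a b).
Qed.

End PlanarSparsity.

Theorem theorem3p1 (T : finType) (e : rel T) (t : nat)
    (VH : {set T}) (eH : rel T) (cv : T -> nat) (ce : T -> T -> nat) :
  symmetric e -> irreflexive e -> planar e ->
  1 <= t <= 4 ->
  28 - t <= maxdeg e ->
  distance3_cliques e VH eH ->
  total_coloring VH eH (maxdeg e + t) cv ce ->
  exists (cv' : T -> nat) (ce' : T -> T -> nat),
    [/\ total_coloring [set: T] e (maxdeg e + t) cv' ce',
        (forall v, v \in VH -> cv' v = cv v) &
        (forall u v, eH u v -> ce' u v = ce u v)].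
Proof.
move=> es ei pe t4 De HH tc.
have dk v : deg e v < maxdeg e + t.
  by have : deg e v <= maxdeg e := leq_bigmax v; lia.
by apply: (extend_precoloring _ es ei (planar_sparse es ei pe) HH dk tc); lia.
Qed.
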